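(* Let $\mathcal G'$ be a given subset of $\mathrm{int}(\mathcal G)$. Let $\nu_1,\nu_2,\dots$ be generated by the mirror descent algorithm with learning rate $\rho>0$ (so that $\nu_{t+1}$ is a deterministic function of $f_1,\dots,f_t$), and for $t=0,\dots,T$ put $$\widehat V_T(\mathcal G'|f_1,\dots,f_t)=\sup_{\mu\in\mathcal G'}\Big\{\sum_{s=1}^t\langle\mu,-f_s\rangle+\frac1\rho D_F(\mu,\nu_{t+1})\Big\}+2\rho(T-t).$$ Suppose that the learning rate $\rho$ is such that $\rho\|f_t\|^*_{\nabla F(\nu_t)}\le1/2$ for all $t=1,\dots,T$, and assume that $\|f_t\|^*_{\nabla F(\nu_t)}\le1$ for all $t=1,\dots,T$. Then the relaxation $\widehat V_T$ is admissible, and the algorithm that generates the sequence $\{\nu_t\}$ is also admissible: $$\widehat V_T(\mathcal G'|f_1,\dots,f_{t-1})\ge\sup_{f\in\mathcal F}\big\{\langle\nu_t,f\rangle+\widehat V_T(\mathcal G'|f_1,\dots,f_{t-1},f)\big\}.$$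
   Context: $\mathsf X,\mathsf U$ are finite sets (states, actions) and $K(y|x,u)$ is a fixed transition kernel. $\mathcal F$ is a fixed class of functions $\mathsf X\times\mathsf U\to\mathbb R$ (the possible cost functions $f_t$); $T$ is a fixed finite horizon; $\langle\nu,f\rangle=\sum_{x,u}\nu(x,u)f(x,u)$. State-action polytope: $$\mathcal G=\Big\{\nu\ \text{probability distribution on }\mathsf X\times\mathsf U:\ \sum_{x,u}K(y|x,u)\nu(x,u)=\sum_u\nu(y,u)\ \forall y\in\mathsf X\Big\}.$$ It is taken to be a compact convex subset of $\mathbb R^{|\mathsf X|\times|\mathsf U|}$ with nonempty interior $\mathrm{int}(\mathcal G)$. A sequence of functions $\widehat V_T(\mathcal G'|f_1,\dots,f_t)$, $t=0,\dots,T$, is an admissible relaxation if for any $f_1,\dots,f_T\in\mathcal F$ $$\widehat V_T(\mathcal G'|f_1,\dots,f_t)\ge\inf_{\nu\in\mathcal G'}\sup_{f\in\mathcal F}\big\{\langle\nu,f\rangle+\widehat V_T(\mathcal G'|f_1,\dots,f_t,f)\big\},\quad t=T-1,\dots,0,$$ $$\widehat V_T(\mathcal G'|f_1,\dots,f_T)\ge-\inf_{\nu\in\mathcal G'}\sum_{t=1}^T\langle\nu,f_t\rangle.$$ Let $\mathcal K\subseteq\mathbb R^n$ be closed, convex, with nonempty interior. A function $F:\mathrm{int}(\mathcal K)\to\mathbb R$ is a barrier on $\mathcal K$ if $F(x_i)\to+\infty$ along any sequence of points of $\mathrm{int}(\mathcal K)$ converging to a boundary point of $\mathcal K$. It is self-concordant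 if it is convex, $C^3$, and $\nabla^3F(v)[h,h,h]\le2(\nabla^2F(v)[h,h])^{3/2}$ for all $v\in\mathrm{int}(\mathcal K)$, $h\in\mathbb R^n$. The Bregman divergence is $D_F(v,w)=F(v)-F(w)-\langle\nabla F(w),v-w\rangle$, $v,w\in\mathrm{int}(\mathcal K)$. The Legendre–Fenchel dual is $F^*(h)=\sup_{v\in\mathrm{int}(\mathcal K)}\{\langle h,v\rangle-F(v)\}$, and the dual local norm of $f$ at $h$ is $\|f\|^*_h=\sqrt{\langle f,\nabla^2F^*(h)f\rangle}$. Standing assumption (with $\mathcal K=\mathcal G$): $\mathcal G$ admits a self-concordant barrier $F:\mathrm{int}(\mathcal G)\to\mathbb R$ such that (1) $F$ is strictly convex on $\mathrm{int}(\mathcal G)$ and $F^*$ is strictly convex on $\mathbb R^{|\mathsf X|\times|\mathsf U|}$; (2) the gradient map $\nu\mapsto\nabla F(\nu)$ is a bijection between $\mathrm{int}(\mathcal G)$ and $\mathbb R^{|\mathsf X|\times|\mathsf U|}$ with inverse $h\mapsto\nabla F^*(h)$; (3) the minimum value of $F$ on $\mathrm{int}(\mathcal G)$ is $0$. Mirror descent algorithm with learning rate $\rho>0$: $\nu_1=\operatorname{arg\,min}_{\nu\in\mathrm{int}(\mathcal G)}F(\nu)$ and, for $t\ge2$, $\nu_t=\nabla F^*\big(\nabla F(\nu_{t-1})-\rho f_{t-1}\big)$.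
   Formalization: int(G), empty in the full space, is read as relative interior, with gradients of F along the affine hull; admissibility with the infimum over G' is claimed only if the iterates lie in G' (false otherwise), and the recursion with infimum over int(G) is proved unconditionally. *)

(* Defs.v *)
From HB Require Import structures.
From mathcomp Require Import all_boot all_order all_algebra.
From mathcomp Require Import all_classical all_reals all_analysis.

Set Implicit Arguments.
Unset Strict Implicit.
Unset Printing Implicit Defensive.

Import Order.TTheory GRing.Theory Num.Theory.
Import numFieldNormedType.Exports.

Local Open Scope classical_set_scope.
Local Open Scope ring_scope.

Section Euclidean.
Context {R : realType} {n : nat}.
Local Notation E := 'rV[R]_n.
Implicit Types (C S L : set E) (F : E -> R) (v w h : E).

Definition dotv v w : R := \sum_(i < n) v ord0 i * w ord0 i.

(* The direction space of the affine hull of C, for C convex: in that case the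
   set of multiples of differences is closed under addition. *)
Definition dirsp C : set E :=
  [set h | exists a v w, [/\ C v, C w & h = a *: (v - w)]].

(* Interior of C inside its affine hull.  See rint_full for convex bodies of
   full dimension. *)
Definition rint C : set E :=
  [set v | C v /\ \forall w \near v, dirsp C (w - v) -> C w].

Lemma rint_full C : dirsp C = setT -> rint C = C°.
Proof.
move=> CT; apply/seteqP; split=> v /=.
  by case=> _; rewrite CT /interior /= => H; near=> w; apply: (near H w).
move=> Cv; split; first exact: (@interior_subset _ C v Cv).
by move: Cv; rewrite /interior /=; apply: filterS => w.
Unshelve. all: by end_near. Qed.

(* Gradient relative to a linear subspace L, represented by an element of L.
   A function on rint C is only differentiated along L = dirsp C, so its
   values outside of rint C are irrelevant. *)
Definition grad L (f : E -> R) v : E :=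
  xget 0 [set g | L g /\ forall h, L h -> is_derive v h (f : E -> R^o) (dotv g h)].

Fixpoint Cn_on (k : nat) L S (f : E -> R) : Prop :=
  {within S, continuous (f : E -> R^o)} /\
  if k is k'.+1 then
    forall h, L h ->
      (forall v, S v -> derivable (f : E -> R^o) v h) /\
      Cn_on k' L S ('D_h (f : E -> R^o))
  else True.

Definition strictly_convex_on S (f : E -> R) :=
  forall v w, S v -> S w -> v != w -> forall t : R, 0 < t -> t < 1 ->
    f (t *: v + (1 - t) *: w) < t * f v + (1 - t) * f w.

Definition barrier C F :=
  forall (u : nat -> E) v, (forall k, rint C (u k)) ->
    u k @[k --> \oo] --> v -> C v -> ~ rint C v ->
    F (u k) @[k --> \oo] --> +oo.

Definition D2 F v h : R := 'D_h ('D_h (F : E -> R^o)) v.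
Definition D3 F v h : R := 'D_h ('D_h ('D_h (F : E -> R^o))) v.

Definition self_concordant C F :=
  [/\ convex_function (rint C) F,
      Cn_on 3 (dirsp C) (rint C) F
    & forall v h, rint C v -> dirsp C h ->
        D3 F v h <= 2 * (D2 F v h) `^ (3 / 2)].

Definition bregman C F v w : R :=
  F v - F w - dotv (grad (dirsp C) F w) (v - w).

(* A real supremum: for C compact and F bounded below on rint C, the set is
   bounded above. *)
Definition dual C F h : R := sup [set dotv h v - F v | v in rint C].

(* The dual is finite on the whole space, with its ordinary gradient and
   Hessian.  Even when C is not of full dimension, grad_dual h is a point of
   rint C, and it is unchanged when a vector orthogonal to dirsp C is added
   to h. *)
Definition grad_dual C F h : E := grad setT (dual C F) h.

Definition hessian (f : E -> R) h : 'M[R]_n :=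
  \matrix_(i, j) 'D_(delta_mx ord0 i) ('D_(delta_mx ord0 j) (f : E -> R^o)) h.

Definition dual_norm C F h v : R :=
  Num.sqrt ((v *m hessian (dual C F) h *m v^T) ord0 ord0).

Record legendre_barrier C F : Prop := LegendreBarrier {
  lb_barrier : barrier C F;
  lb_self_concordant : self_concordant C F;
  lb_strict : strictly_convex_on (rint C) F;
  lb_dual_strict : strictly_convex_on (dirsp C) (dual C F);
  lb_dual_diff : forall h, differentiable (dual C F : E -> R^o) h;
  lb_grad_bij : set_bij (rint C) (dirsp C) (grad (dirsp C) F);
  lb_grad_inv : forall v, rint C v -> grad_dual C F (grad (dirsp C) F v) = v;
  lb_min : (exists2 v, rint C v & F v = 0) /\ forall v, rint C v -> 0 <= F v
}.

Definition is_argmin S F v := S v /\ forall w, S w -> F v <= F w.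

(* mirror_descent C F rho nu1 [:: f_1; ...; f_t] is nu_{t+1} *)
Definition mirror_descent C F (rho : R) (nu1 : E) (s : seq E) : E :=
  foldl (fun nu f => grad_dual C F (grad (dirsp C) F nu - rho *: f)) nu1 s.

Definition mirror_relaxation C F rho nu1 (T : nat) (G' : set E) (s : seq E)
    : \bar R :=
  (ereal_sup [set (\sum_(f <- s) dotv mu (- f) +
                   rho^-1 * bregman C F mu (mirror_descent C F rho nu1 s))%:E
             | mu in G']
   + (2 * rho * (T%:R - (size s)%:R))%:E)%E.

Variables (calF : set E) (T : nat).

Definition costs (fs : T.-tuple E) := forall f, f \in (fs : seq E) -> calF f.

(* A relaxation V maps [:: f_1; ...; f_t] to V(f_1, ..., f_t); D is the set
   of distributions over which the learner minimizes. *)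
Definition relaxation_step (D : set E) (V : seq E -> \bar R) :=
  forall fs, costs fs -> forall t, (t < T)%N ->
    (ereal_inf [set ereal_sup [set (dotv nu f)%:E + V (rcons (take t fs) f)
                              | f in calF] | nu in D]
     <= V (take t fs))%E.

Definition relaxation_final (G' : set E) (V : seq E -> \bar R) :=
  forall fs, costs fs ->
    (- ereal_inf [set (\sum_(f <- fs) dotv nu f)%:E | nu in G'] <= V fs)%E.

Definition admissible_relaxation (G' : set E) (V : seq E -> \bar R) :=
  relaxation_step G' V /\ relaxation_final G' V.

Definition admissible_algorithm (nu : seq E -> E) (V : seq E -> \bar R) :=
  forall fs, costs fs -> forall t, (t < T)%N ->
    (ereal_sup [set (dotv (nu (take t fs)) f)%:E + V (rcons (take t fs) f)
               | f in calF] <= V (take t fs))%E.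

End Euclidean.

Section Polytope.
Context {R : realType} {X U : finType}.
Implicit Type K : X -> U -> X -> R.

(* A function on X * U is a row vector indexed by the enumeration of X * U. *)
Local Notation E := 'rV[R]_#|{: X * U}|.

Definition ev (nu : E) (x : X) (u : U) : R := nu ord0 (enum_rank (x, u)).

(* K x u y is K(y|x,u) *)
Definition transition_kernel K :=
  (forall x u y, 0 <= K x u y) /\ (forall x u, \sum_y K x u y = 1).

Definition state_action_polytope K : set E :=
  [set nu | [/\ forall x u, 0 <= ev nu x u,
                \sum_x \sum_u ev nu x u = 1
              & forall y, \sum_x \sum_u K x u y * ev nu x u = \sum_u ev nu y u]].

(* Being contained in the simplex, the polytope has empty interior in the
   ambient space, which is why rint is used. *)
Lemma interior_state_action_polytope K : (state_action_polytope K)° = set0.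
Proof.
apply/seteqP; split=> // v; rewrite /interior /= => Gv.
have [_ sv1 _] := nbhs_singleton Gv.
have : (fun t : R => t *: v) @ (1 : R) --> (1 : R) *: v.
  by apply: cvgZr_tmp; exact: cvg_id.
rewrite scale1r => /(_ _ Gv); rewrite near_simpl => H.
have /nbhs_ballP[e /= e0 He] : nbhs (1 : R) [set t | state_action_polytope K (t *: v)].
  exact: H.
have [|_ + _] := He (1 + e / 2).
  by rewrite /ball /= opprD addNKr normrN gtr0_norm ?divr_gt0// gtr_pMr// invf_lt1 ?ltr1n.
under eq_bigr do under eq_bigr do rewrite /ev mxE.
under eq_bigr do rewrite -mulr_sumr.
rewrite -mulr_sumr [X in _ * X]sv1 mulr1 => /eqP.
by rewrite -subr_eq0 addrC addKr mulf_eq0 invr_eq0 pnatr_eq0 orbF gt_eqF.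
Qed.

End Polytope.

(* Main.v *)
(**
For one step [a = nu_t], [b = nu_(t+1)] with cost [f], the three-point identity
of Bregman divergences reduces admissibility to [D_F(a, b) <= 2 rho^2].  As
[D_F(b, a) >= 0], the left-hand side is at most
[<grad F a - grad F b, a - b> = rho <f, a - b> <= l r], where [l] is
[rho] times the dual norm of [f] and [r] is the norm of [a - b] for the Hessian
of [F] at [a].  Self-concordance along the segment bounds the same scalar
product from below by [r^2 / (1 + r)], so [r <= 2 l] because [l <= 1/2], and
[D_F(a, b) <= 2 l^2 <= 2 rho^2].

The Cauchy-Schwarz inequality between the two norms needs the Hessian of the
dual.  Self-concordance and strict convexity make the Hessian of [F] positive
definite on [dirsp C]; the same lower bound then shows that the gradient of the
dual, the inverse of [grad F], is pointwise Lipschitz, and the first-order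
expansion of [grad F] shows that it is differentiable with the inverse Hessian
as derivative.
*)

Require Import Defs.
From HB Require Import structures.
From mathcomp Require Import all_boot all_order all_algebra.
From mathcomp Require Import all_classical all_reals all_analysis.
From mathcomp Require Import ring lra.

Set Implicit Arguments.
Unset Strict Implicit.
Unset Printing Implicit Defensive.

Import Order.TTheory GRing.Theory Num.Theory.
Import numFieldNormedType.Exports.

Local Open Scope classical_set_scope.
Local Open Scope ring_scope.

(** * Directional derivatives *)

Section DirectionalDerivatives.
Context {R : realType}.
Implicit Types V W : normedModType R.

(** A directional derivative sees [f] only along one line, so precomposition with a map that is
    affine along [h] keeps the difference quotients themselves. No chain rule, hence no
    differentiability of [f], enters. *)
Lemma growth_rate_affine V W (f : W -> R^o) (g : V -> W) x h k :
  (forall t : R, g (t *: h + x) = t *: k + g x) ->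
  (fun t : R => t^-1 *: (((f \o g) \o shift x) (t *: h) - (f \o g) x)) =
  (fun t : R => t^-1 *: ((f \o shift (g x)) (t *: k) - f (g x))).
Proof. by move=> gE; apply/funext => t /=; rewrite gE. Qed.

Lemma derive_affine V W (f : W -> R^o) (g : V -> W) x h k :
  (forall t : R, g (t *: h + x) = t *: k + g x) ->
  'D_h (f \o g) x = 'D_k f (g x).
Proof. by move=> /(growth_rate_affine f) gE; rewrite /derive gE. Qed.

Lemma derivable_affine V W (f : W -> R^o) (g : V -> W) x h k :
  (forall t : R, g (t *: h + x) = t *: k + g x) ->
  derivable f (g x) k -> derivable (f \o g) x h.
Proof. by move=> /(growth_rate_affine f) gE; rewrite /derivable gE. Qed.

Lemma is_derive_line V (f : V -> R^o) x v (s : R) :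
  derivable f (x + s *: v) v ->
  is_derive s 1 (fun s : R => f (x + s *: v) : R^o) ('D_v f (x + s *: v)).
Proof.
move=> fv; pose g (s : R) : V := x + s *: v.
have gE t : g (t *: 1 + s) = t *: v + g s.
  by rewrite /g [t *: 1]mulr1 scalerDl addrCA.
by split; [exact: derivable_affine gE fv | exact: (derive_affine f gE)].
Qed.

Lemma is_derive1_continuous (f : R -> R) (s d : R) :
  is_derive s 1 (f : R -> R^o) d -> {for s, continuous f}.
Proof.
by case=> + _ => /derivable1_diffP/differentiable_continuous.
Qed.

(** Both signs of [t] are allowed, because it will be a coordinate of an arbitrary increment. *)
Lemma mvt_line V (f : V -> R^o) x v (t : R) :
  (forall s : R, `|s| <= `|t| -> derivable f (x + s *: v) v) ->
  exists2 s : R, `|s| <= `|t| &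
    f (x + t *: v) - f x = t * 'D_v f (x + s *: v).
Proof.
move=> fv; pose g (s : R) : R := f (x + s *: v).
have dg (s : R) : `|s| <= `|t| ->
    is_derive s 1 (g : R -> R^o) ('D_v f (x + s *: v)).
  by move=> /fv; exact: is_derive_line.
have cg (s : R) : `|s| <= `|t| -> {for s, continuous g}.
  by move=> /dg/is_derive1_continuous.
have wcg (A : set R) : (forall s, A s -> `|s| <= `|t|) ->
    {within A, continuous g}.
  move=> At; apply: continuous_in_subspaceT => s; rewrite inE => /At; exact: cg.
have g0 : g 0 = f x by rewrite /g scale0r addr0.
have [t0|t0] := leP 0 t.
  have st s : s \in `[0, t] -> `|s| <= `|t|.
    by rewrite in_itv/= => /andP[s0 st]; rewrite !ger0_norm.
  have [|s /st sle] :=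
    MVT_segment t0 (fun s st' => dg s (st s (subset_itv_oo_cc st'))).
    by apply: wcg => s /st.
  by rewrite subr0 g0 mulrC => E; exists s.
have st s : s \in `[t, 0] -> `|s| <= `|t|.
  by rewrite in_itv/= => /andP[s0 st]; rewrite !ler0_norm// ?lerN2// ltW.
have [|s /st sle] :=
  MVT_segment (ltW t0) (fun s st' => dg s (st s (subset_itv_oo_cc st'))).
  by apply: wcg => s /st.
by rewrite sub0r g0 mulrN -opprB => /oppr_inj; rewrite mulrC => E; exists s.
Qed.

End DirectionalDerivatives.

(** * Differentiability from continuous partial derivatives *)

Section RowVectors.
Context {R : realType} {n : nat}.
Local Notation E := 'rV[R]_n.
Local Notation e j := (delta_mx ord0 j : E).

Lemma rV_normP (x : E) (r : R) : 0 <= r ->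
  reflect (forall j, `|x ord0 j| <= r) (`|x| <= r).
Proof.
move=> r0; rewrite [`|x|]mx_normrE.
apply: (iffP (bigmax_leP _ _ _ _)) => [[_ H] j|H]; first exact: (H (ord0, j)).
by split=> // -[i j] _ /=; rewrite ord1.
Qed.

Lemma ler_coord_norm (x : E) j : `|x ord0 j| <= `|x|.
Proof. by apply/(rV_normP x (normr_ge0 x)). Qed.

Lemma continuous_linear_rV (W : normedModType R) (f : {linear E -> W}) :
  continuous f.
Proof.
move=> x.
have -> : (f : E -> W) = \sum_j (fun y : E => y ord0 j *: f (e j)).
  apply/funext => y; rewrite fct_sumE {1}[y]row_sum_delta linear_sum.
  by apply: eq_bigr => j _; rewrite linearZ.
elim/big_ind: _ => [|g h cg ch|j _]; first exact: cst_continuous.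
  exact: continuousD.
by apply: continuousZr_tmp; exact: coord_continuous.
Qed.

(** The increment from [x] to [x + d] is split into moves along the axes. The mean value theorem on
    each move gives a partial derivative at a point near [x], and continuity replaces it by the one
    at [x]. *)
Lemma differentiable_C1 (f : E -> R^o) (x : E) :
  (forall j, \forall y \near x, derivable f y (e j)) ->
  (forall j, {for x, continuous ('D_(e j) f)}) ->
  differentiable f x.
Proof.
move=> df cf.
pose l (d : E) : R^o := (d *m \col_j 'D_(e j) f x) ord0 ord0.
have linl : linear l by move=> a u v; rewrite /l mulmxDl -scalemxAl !mxE.
pose L : {linear E -> R^o} := HB.pack l (GRing.isLinear.Build _ _ _ _ l linl).
have lE d : L d = \sum_j d ord0 j * 'D_(e j) f x.
  by rewrite /L/= /l mxE; apply: eq_bigr => j _; rewrite mxE.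
have cL : continuous L by exact: continuous_linear_rV.
have key (eps : R) : 0 < eps ->
    \forall d \near (0 : E), `|f (d + x) - (f x + L d)| <= eps * `|d|.
  move=> eps0.
  (* There are [n] moves, each with error [eps' * |d|]; dividing by [n.+1] also covers [n = 0]. *)
  pose eps' := eps / n.+1%:R.
  have eps'0 : 0 < eps' by rewrite divr_gt0.
  have /filter_forall H : forall j, \forall y \near x, derivable f y (e j) /\
      `|'D_(e j) f x - 'D_(e j) f y| <= eps'.
    move=> j; near=> y; split; first by near: y; exact: df.
    near: y.
    exact: (@cvgr_dist_le _ R^o _ _ _ _ _ (cf j) _ eps'0).
  have /nbhs_ballP[r /= r0 {}H] := H.
  apply/nbhs_ballP; exists r => //= d.
  rewrite mx_norm_ball /ball_/= sub0r normrN => dr.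
  have Hd y : `|y| <= `|d| -> forall j, derivable f (x + y) (e j) /\
      `|'D_(e j) f x - 'D_(e j) f (x + y)| <= eps'.
    move=> yd; apply: (H (x + y)).
    rewrite mx_norm_ball /ball_/= opprD addNKr normrN.
    exact: le_lt_trans dr.
  (* [D k] keeps the first [k] coordinates of [d], so that [f (x + d) - f x] telescopes along
     [x + D k]. *)
  pose D k : E := \row_i (if (i < k)%N then d ord0 i else 0).
  have DS (k : 'I_n) : D k.+1 = D k + d ord0 k *: e k.
    apply/rowP => i; rewrite !mxE eqxx /= ltnS leq_eqVlt val_eqE.
    by have [->|ik] /= := eqVneq i k; rewrite ?ltnn ?add0r ?mulr1 ?mulr0 ?addr0.
  have Dle (k : 'I_n) s : `|s| <= `|d ord0 k| -> `|D k + s *: e k| <= `|d|.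
    move=> sd; apply/rV_normP => // i; rewrite !mxE eqxx/=.
    have [->|ik] := eqVneq i k.
      by rewrite ltnn add0r mulr1 (le_trans sd)// ler_coord_norm.
    by rewrite mulr0 addr0; case: ifP; rewrite ?normr0// ler_coord_norm.
  have D0 : D 0%N = 0 by apply/rowP => i; rewrite !mxE.
  have Dn : D n = d by apply/rowP => i; rewrite !mxE ltn_ord.
  have -> : f (d + x) - (f x + L d) =
      \sum_(k < n) (f (x + D k.+1) - f (x + D k) - d ord0 k * 'D_(e k) f x).
    rewrite sumrB -(big_mkord xpredT (fun k => f (x + D k.+1) - f (x + D k))).
    rewrite telescope_sumr// D0 Dn addr0 -lE opprD addrA.
    by rewrite [d + x]addrC.
  rewrite (le_trans (ler_norm_sum _ _ _))//.
  apply: (@le_trans _ _ (\sum_(k < n) eps' * `|d|)); last first.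
    rewrite sumr_const card_ord -mulr_natl mulrA ler_wpM2r// /eps'.
    rewrite mulrCA ger_pMr// ler_pdivrMr// mul1r ler_nat. exact: leqnSn.
  apply: ler_sum => k _.
  have [s sle] : exists2 s : R, `|s| <= `|d ord0 k| &
     f (x + D k.+1) - f (x + D k) = d ord0 k * 'D_(e k) f (x + D k + s *: e k).
    rewrite DS addrA; apply: mvt_line => s sle.
    by rewrite -addrA; apply: (Hd _ _ k).1; exact: Dle.
  move=> ->; rewrite -mulrBr normrM mulrC ler_pM ?ler_coord_norm//.
  rewrite distrC -addrA; exact: (Hd _ (Dle _ _ sle) k).2.
have dE : 'd f x = L :> (E -> R^o).
  by apply: diff_unique => //; apply/eqaddoP => eps; exact: key.
apply/diff_locallyP; rewrite dE; split=> //.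
by apply/eqaddoP => eps; exact: key.
Unshelve. all: by end_near. Qed.

End RowVectors.

(** * Symmetry of second derivatives *)

Section SecondDerivatives.
Context {R : realType} (V : normedModType R).
Implicit Types (f : V -> R^o) (x u v : V).

(** The mean value theorem is applied twice: along [u] to the difference of [f] and its translate by
    [t *: v], then along [v] to ['D_u f]. *)
Lemma second_difference f x u v (t : R) :
  (forall a b : R, `|a| <= `|t| -> `|b| <= `|t| ->
     derivable f (x + a *: u + b *: v) u) ->
  (forall a b : R, `|a| <= `|t| -> `|b| <= `|t| ->
     derivable ('D_u f) (x + a *: u + b *: v) v) ->
  exists a b : R, [/\ `|a| <= `|t|, `|b| <= `|t| &
    f (x + t *: u + t *: v) - f (x + t *: u) - f (x + t *: v) + f x =
    t ^+ 2 * 'D_v ('D_u f) (x + a *: u + b *: v)].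
Proof.
move=> df ddf.
pose S (y : V) := y + t *: v.
have SE y (r : R) : S (r *: u + y) = r *: u + S y by rewrite /S addrA.
pose g (y : V) : R^o := (f \o S) y - f y.
have dg (a : R) : `|a| <= `|t| ->
    derivable (f \o S) (x + a *: u) u /\ derivable f (x + a *: u) u.
  move=> at_; split; last by have := df a 0 at_; rewrite scale0r addr0 normr0; apply.
  by apply: (derivable_affine (SE _)); rewrite /S; exact: df.
have [|a at_ gE] := @mvt_line _ V g x u t.
  by move=> s /dg[? ?]; exact: derivableB.
have [|b bt dE] := @mvt_line _ V ('D_u f) (x + a *: u) v t.
  by move=> s st; exact: ddf.
exists a, b; split=> //.
rewrite expr2 -mulrA -dE.
have [? ?] := dg _ at_.
move: gE; rewrite deriveB// (derive_affine f (SE _)) /S => <-.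
by rewrite /g /= /S; ring.
Qed.

(** The second difference is symmetric in [u] and [v], so the two mixed derivatives take a common
    value at two points near [x]; continuity carries this back to [x]. *)
Lemma derive_swap f x u v :
  (\forall y \near x, [/\ derivable f y u, derivable f y v,
     derivable ('D_u f) y v & derivable ('D_v f) y u]) ->
  {for x, continuous ('D_v ('D_u f))} -> {for x, continuous ('D_u ('D_v f))} ->
  'D_v ('D_u f) x = 'D_u ('D_v f) x.
Proof.
move=> df cuv cvu; apply/eqP; rewrite -subr_eq0 -normr_eq0.
apply/eqP/le_anti; rewrite normr_ge0 andbT; apply/ler_addgt0Pr => e e0.
rewrite add0r; have e20 : 0 < e / 2 by rewrite divr_gt0.
have [r /= r0 H] : exists2 r : R, 0 < r & forall y, `|y| < r ->
  [/\ derivable f (x + y) u, derivable f (x + y) v,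
     derivable ('D_u f) (x + y) v & derivable ('D_v f) (x + y) u] /\
  (`|'D_v ('D_u f) x - 'D_v ('D_u f) (x + y)| <= e / 2 /\
   `|'D_u ('D_v f) x - 'D_u ('D_v f) (x + y)| <= e / 2).
  have /nbhs_ballP[r /= r0 H] : \forall y \near x,
    [/\ derivable f y u, derivable f y v,
     derivable ('D_u f) y v & derivable ('D_v f) y u] /\
    (`|'D_v ('D_u f) x - 'D_v ('D_u f) y| <= e / 2 /\
     `|'D_u ('D_v f) x - 'D_u ('D_v f) y| <= e / 2).
    apply: filterI => //; apply: filterI.
      exact: (@cvgr_dist_le _ R^o _ _ _ _ _ cuv _ e20).
    exact: (@cvgr_dist_le _ R^o _ _ _ _ _ cvu _ e20).
  exists r; first exact: r0.
  move=> y yr; apply: (H (x + y)).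
  by rewrite -ball_normE/= opprD addNKr normrN.
(* This size keeps the whole parallelogram spanned by [t *: u] and [t *: v] within [r] of [x]; the
   [1] covers [u = v = 0]. *)
pose t := r / (2 * (`|u| + `|v| + 1)).
have t0 : 0 < t by rewrite divr_gt0// mulr_gt0// ltr_wpDl// addr_ge0.
have tr (a b : R) : `|a| <= `|t| -> `|b| <= `|t| -> `|a *: u + b *: v| < r.
  rewrite (gtr0_norm t0) => at_ bt; apply: le_lt_trans (ler_normD _ _) _.
  rewrite !normrZ; apply: (@le_lt_trans _ _ (t * (`|u| + `|v| + 1))).
    rewrite !mulrDr mulr1; apply: ler_wpDr; first exact: ltW.
    by apply: lerD; exact: ler_wpM2r.
  rewrite /t invfM mulrA mulfVK; last by rewrite gt_eqF// ltr_wpDl// addr_ge0.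
  by rewrite ltr_pdivrMr// ltr_pMr// ltr1n.
have [||a [b [/tr{}at_ /at_ bt E1]]] := @second_difference f x u v t.
- by move=> a b /tr{}at_ /at_ /H[[+ _ _ _] _]; rewrite addrA.
- by move=> a b /tr{}at_ /at_ /H[[_ _ + _] _]; rewrite addrA.
have [||b' [a' [bt' /tr{}at_' E2]]] := @second_difference f x v u t.
- by move=> c d ct /tr/(_ ct)/H[[_ + _ _] _]; rewrite addrA addrAC.
- by move=> c d ct /tr/(_ ct)/H[[_ _ _ +] _]; rewrite addrA addrAC.
have {}at_' := at_' _ bt'.
have [_ [B1 _]] := H _ bt.
have [_ [_ B2]] := H _ at_'.
rewrite !addrA in B1 B2.
have E : 'D_v ('D_u f) (x + a *: u + b *: v) =
    'D_u ('D_v f) (x + a' *: u + b' *: v).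
  apply: (@mulfI _ (t ^+ 2)); first by rewrite expf_neq0// gt_eqF.
  rewrite -E1 [x + a' *: u + _]addrAC -E2 [x + t *: v + _]addrAC; ring.
rewrite [leRHS]splitr; apply: le_trans (lerD B1 B2).
rewrite E [X in _ <= _ + X]distrC; apply: le_trans (ler_normD _ _).
by rewrite addrA subrK.
Qed.

End SecondDerivatives.

(** * Self-concordance on a line *)

Section SelfConcordantLines.
Context {R : realType}.
Implicit Types (g dg p u du : R -> R) (a b s : R).

Lemma ge0_is_derive_le g dg a b : a <= b ->
  (forall s, a <= s <= b -> is_derive s 1 (g : R -> R^o) (dg s)) ->
  (forall s, a <= s <= b -> 0 <= dg s) -> g a <= g b.
Proof.
move=> ab Dg dg0.
have [s /subset_itv_oo_cc||c] := @MVT_segment R g dg a b ab.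
- by rewrite in_itv/=; exact: Dg.
- apply: continuous_in_subspaceT => s; rewrite inE/= in_itv/= => /Dg.
  exact: is_derive1_continuous.
- by rewrite in_itv/= => /dg0 dc E; rewrite -subr_ge0 E mulr_ge0// subr_ge0.
Qed.

(* The inequality on [du] says that [Num.sqrt (u s)] has a reciprocal with
   derivative at least [-1]; integrating twice from the right end gives the
   bound. *)
Lemma self_concordant_gap p u du :
  (forall s, 0 <= s <= 1 -> is_derive s 1 (p : R -> R^o) (u s)) ->
  (forall s, 0 <= s <= 1 -> is_derive s 1 (u : R -> R^o) (du s)) ->
  (forall s, 0 <= s <= 1 -> 0 < u s) ->
  (forall s, 0 <= s <= 1 -> du s <= 2 * u s `^ (3 / 2)) ->
  u 1 / (1 + Num.sqrt (u 1)) <= p 1 - p 0.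
Proof.
move=> Dp Du u0 scu.
set r := Num.sqrt (u 1).
have r0 : 0 < r by rewrite sqrtr_gt0 u0// ler01 lexx.
have sq s : 0 <= s <= 1 -> 0 < Num.sqrt (u s) by move=> /u0; rewrite sqrtr_gt0.
have w_le s : 0 <= s <= 1 -> (Num.sqrt (u s))^-1 <= r^-1 + 1 - s.
  move=> /andP[s0 s1]; rewrite lerBrDr.
  apply: (@ge0_is_derive_le (fun s => (Num.sqrt (u s))^-1 + s)
    (fun s => - Num.sqrt (u s) ^- 2 *:
       ((2 * Num.sqrt (u s))^-1 * du s) + 1)) => //.
    move=> x /andP[sx x1]; have x01 : 0 <= x <= 1 by rewrite x1 (le_trans s0).
    apply: is_deriveD; apply: is_deriveV; first by rewrite gt_eqF// sq.
    apply: (@is_derive1_comp _ Num.sqrt u); last exact: Du.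
    exact/is_derive1_sqrt/u0.
  move=> x /andP[sx x1]; have x01 : 0 <= x <= 1 by rewrite x1 (le_trans s0).
  have q0 := sq _ x01; have := scu _ x01.
  have -> : u x `^ (3 / 2) = Num.sqrt (u x) ^+ 3.
    rewrite -powR12_sqrt ?ltW ?u0// -powR_mulrn ?powR_ge0// -powRrM.
    by congr (_ `^ _); rewrite mulrC.
  move=> dux; rewrite [_ *: _]mulNr addrC subr_ge0 mulrA -invfM.
  rewrite ler_pdivrMl ?mulr1; last by rewrite !mulr_gt0// exprn_gt0.
  by apply: le_trans dux _; rewrite le_eqVlt; apply/orP; left; apply/eqP; ring.
have c0 s : 0 <= s <= 1 -> 0 < r^-1 + 1 - s.
  by move=> /andP[_ s1]; rewrite -addrA ltr_wpDr ?invr_gt0// subr_ge0.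
(* By [w_le], [u s] is at least [(r^-1 + 1 - s) ^- 2], which has the explicit primitive subtracted
   here; that primitive equals [r] at [1]. *)
have := @ge0_is_derive_le (fun s => p s - (r^-1 + 1 - s)^-1)
  (fun s => u s - (r^-1 + 1 - s) ^- 2) 0 1 ler01.
move=> /(_ _ _)/wrap[||].
- move=> s s01; apply: is_deriveB; first exact: Dp.
  have := @is_deriveV _ (fun y => r^-1 + 1 - y) s (-1) 1.
  rewrite [_ *: _]mulNr mulrN1 opprK; apply; first by rewrite gt_eqF// c0.
  rewrite -[X in is_derive _ _ _ X]add0r.
  by apply: is_deriveB.
- move=> s s01; rewrite subr_ge0 -[leRHS]sqr_sqrtr; last exact/ltW/u0.
  rewrite -exprVn ler_sqr ?nnegrE ?invr_ge0 ?sqrtr_ge0//; last exact/ltW/c0.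
  rewrite -[leRHS]invrK lef_pV2 ?posrE ?invr_gt0 ?sq ?c0//.
  exact: w_le.
rewrite subr0 addrK invrK => H.
have -> : u 1 / (1 + r) = r - (r^-1 + 1)^-1.
  have -> : u 1 = r ^+ 2 by rewrite sqr_sqrtr// ltW// u0// ler01 lexx.
  by field; rewrite !gt_eqF// addr_gt0.
by move: H; lra.
Qed.

(* Where [u <= 1] the hypothesis on [du] gives [du <= 2 u], so that
   [u s * expR (- 2 s)] is nonincreasing. *)
Lemma self_concordant_zero u du (d : R) : 0 < d ->
  (forall s, 0 <= s <= d -> is_derive s 1 (u : R -> R^o) (du s)) ->
  (forall s, 0 <= s <= d -> 0 <= u s) ->
  (forall s, 0 <= s <= d -> du s <= 2 * u s `^ (3 / 2)) ->
  u 0 = 0 ->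
  exists2 e, 0 < e <= d & forall s, 0 <= s <= e -> u s = 0.
Proof.
move=> d0 Du u0 scu u00.
have cu : {for 0, continuous u}.
  by apply: is_derive1_continuous; apply: Du; rewrite lexx ltW.
have /nbhs_ballP[r /= r0 H] : \forall s \near (0 : R), u s < 1.
  by have /cvgr_lt := cu; apply; rewrite u00.
(* Halving [r] keeps the closed interval inside the open ball where [u < 1]. *)
exists (Num.min d (r / 2)); first by rewrite lt_min d0 divr_gt0// ge_min lexx.
move=> s /andP[s0]; rewrite le_min => /andP[sd sr].
have xd x : 0 <= x <= s -> 0 <= x <= d.
  by move=> /andP[-> xs] /=; exact: le_trans sd.
apply/eqP; rewrite eq_le u0 ?s0// andbT.
have := @ge0_is_derive_le (fun x => - (u x * expR (- 2 * x)))
  (fun x => - (u x * (expR (- 2 * x) * - 2) + expR (- 2 * x) * du x)) 0 s s0.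
move=> /(_ _ _)/wrap[||].
- move=> x /xd xd'; apply: is_deriveN.
  apply: is_deriveM; first exact: Du.
  apply: (@is_derive1_comp _ expR ( *%R (- 2))).
  by have := is_deriveZ (- 2) (is_derive_id x 1); rewrite [_ *: _]mulr1.
- move=> x xs.
  have x1 : u x < 1.
    apply: H; rewrite -ball_normE/= sub0r normrN.
    rewrite ger0_norm; last by case/andP: xs.
    case/andP: xs => _ /le_lt_trans; apply; apply: le_lt_trans sr _.
    by rewrite ltr_pdivrMr// ltr_pMr// ltr1n.
  have ux := u0 _ (xd _ xs).
  have : du x <= 2 * u x.
    apply: le_trans (scu _ (xd _ xs)) _; rewrite ler_pM2l//.
    have [->|un0] := eqVneq (u x) 0; first by rewrite powR0.
    by apply: ge1r_powR; [rewrite lt_neqAle eq_sym un0 ux ltW | lra].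
  have := expR_gt0 (- 2 * x); nra.
rewrite u00 mul0r oppr0 oppr_ge0 pmulr_lle0 ?expR_gt0//.
Qed.

End SelfConcordantLines.

(** * Quadratic forms and orthogonal projections *)

Section InnerProduct.
Context {R : realType} {n : nat}.
Local Notation E := 'rV[R]_n.
Implicit Types (u v w x : E) (A : 'M[R]_n).

Lemma dotv_mx u v : dotv u v = (u *m v^T) ord0 ord0.
Proof. by rewrite mxE; apply: eq_bigr => i _; rewrite mxE. Qed.

Lemma dotvDl u v w : dotv (u + v) w = dotv u w + dotv v w.
Proof. by rewrite !dotv_mx mulmxDl mxE. Qed.

Lemma dotvZl (a : R) u w : dotv (a *: u) w = a * dotv u w.
Proof. by rewrite !dotv_mx -scalemxAl mxE. Qed.

Lemma dotvNl u w : dotv (- u) w = - dotv u w.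
Proof. by rewrite -scaleN1r dotvZl mulN1r. Qed.

Lemma dotvBl u v w : dotv (u - v) w = dotv u w - dotv v w.
Proof. by rewrite dotvDl dotvNl. Qed.

Lemma dotvC u v : dotv u v = dotv v u.
Proof. by apply: eq_bigr => i _; rewrite mulrC. Qed.

Lemma dotvDr u v w : dotv w (u + v) = dotv w u + dotv w v.
Proof. by rewrite ![dotv w _]dotvC dotvDl. Qed.

Lemma dotvZr (a : R) u w : dotv w (a *: u) = a * dotv w u.
Proof. by rewrite ![dotv w _]dotvC dotvZl. Qed.

Lemma dotvNr u w : dotv w (- u) = - dotv w u.
Proof. by rewrite ![dotv w _]dotvC dotvNl. Qed.

Lemma dotvBr u v w : dotv w (u - v) = dotv w u - dotv w v.
Proof. by rewrite dotvDr dotvNr. Qed.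

Lemma dotv0 u : dotv u 0 = 0.
Proof. by rewrite dotv_mx trmx0 mulmx0 mxE. Qed.

Lemma dotv_mulmx u v A : dotv (u *m A) v = dotv u (v *m A^T).
Proof. by rewrite !dotv_mx trmx_mul trmxK mulmxA. Qed.

Lemma dotv_delta u j : dotv u (delta_mx ord0 j) = u ord0 j.
Proof.
rewrite /dotv (bigD1 j)//= big1 => [|i ij]; rewrite mxE eqxx/=.
  by rewrite eqxx mulr1 addr0.
by rewrite (negbTE ij) mulr0.
Qed.

Lemma dotvv_ge0 u : 0 <= dotv u u.
Proof. by apply: sumr_ge0 => i _; rewrite -expr2 sqr_ge0. Qed.

Lemma dotvv_eq0 u : dotv u u = 0 -> u = 0.
Proof.
move=> /eqP; rewrite psumr_eq0 => [/allP u0|i _]; last by rewrite -expr2 sqr_ge0.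
apply/rowP => i; have := u0 i; rewrite mem_index_enum mxE => /(_ isT).
by rewrite mulf_eq0 orbb => /eqP.
Qed.

Lemma dotv_inj u v : (forall w, dotv u w = dotv v w) -> u = v.
Proof. by move=> uv; apply/rowP => j; rewrite -!dotv_delta. Qed.

Lemma cauchy_schwarz_mx A u v : A^T = A -> (forall x, 0 <= dotv (x *m A) x) ->
  dotv (u *m A) v ^+ 2 <= dotv (u *m A) u * dotv (v *m A) v.
Proof.
move=> AT A0.
set p := dotv (u *m A) u; set q := dotv (u *m A) v; set r := dotv (v *m A) v.
have q' : dotv (v *m A) u = q by rewrite dotv_mulmx AT dotvC.
have H (a b : R) : 0 <= a ^+ 2 * p + 2 * a * b * q + b ^+ 2 * r.
  have := A0 (a *: u + b *: v).
  rewrite mulmxDl -!scalemxAl !(dotvDl, dotvDr, dotvZl, dotvZr) q' -/p -/q -/r.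
  rewrite [X in 0 <= X -> _](_ : _ = a ^+ 2 * p + 2 * a * b * q + b ^+ 2 * r)//.
  by ring.
(* The form may be degenerate. If [r = 0] and [q] were nonzero, the coefficient of [v] below would
   give the form the value [-1]. *)
have [r0|] := eqVneq r 0.
  have [->|q0] := eqVneq q 0; first by rewrite r0 mulr0 expr0n.
  have := H 1 (- (p + 1) / (2 * q)).
  have -> : 1 ^+ 2 * p + 2 * 1 * (- (p + 1) / (2 * q)) * q +
    (- (p + 1) / (2 * q)) ^+ 2 * r = -1 by rewrite r0; field.
  by rewrite oppr_ge0 ler10.
move=> rn0; have r0 : 0 < r by rewrite lt_neqAle eq_sym rn0 A0.
have := H r (- q).
have -> : r ^+ 2 * p + 2 * r * - q * q + (- q) ^+ 2 * r = r * (p * r - q ^+ 2).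
  by ring.
by rewrite pmulr_rge0// subr_ge0.
Qed.

Lemma unitmx_posdef A :
  (forall x, x != 0 -> 0 < dotv (x *m A) x) -> A \in unitmx.
Proof.
move=> A0; rewrite -row_free_unit; apply/inj_row_free => x xA.
by apply/eqP/negP => /negP/A0; rewrite xA dotvC dotv0 ltxx.
Qed.

(** A matrix of maximal rank among those with row space inside [L] has row space [L]. For a basis
    [B] of its rows, the projection is [B^T (B B^T)^-1 B]. *)
Lemma orthogonal_projection (L : set E) : L 0 ->
  (forall u v, L u -> L v -> L (u + v)) ->
  (forall (a : R) u, L u -> L (a *: u)) ->
  exists P : 'M[R]_n, [/\ P^T = P, forall x, L (x *m P) &
    forall w, L w -> w *m P = w].
Proof.
move=> L0 LD LZ.
pose in_L (M : 'M[R]_n) := forall h : E, (h <= M)%MS -> L h.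
have ex_rk : exists k, `[< exists2 M, in_L M & \rank M = k >].
  exists 0%N; apply/asboolP; exists 0; last exact: mxrank0.
  by move=> h; rewrite submx0 => /eqP ->.
have rk_le k : `[< exists2 M, in_L M & \rank M = k >] -> (k <= n)%N.
  by move=> /asboolP[M _ <-]; exact: rank_leq_col.
case: (ex_maxnP ex_rk rk_le) => r /asboolP[M LM rM] rmax.
have ML h : L h -> (h <= M)%MS.
  move=> Lh; apply/negP => /negP hM.
  (* A vector of [L] outside the row space would give a matrix of larger rank with rows still in
     [L]. *)
  have : (M < M + h)%MS.
    by rewrite ltmxE addsmxSl addsmx_sub submx_refl/=.
  rewrite ltmxErank => /andP[_]; apply/negP; rewrite -leqNgt rM.
  apply: rmax; apply/asboolP; exists (M + h)%MS => // g.
  move=> /sub_addsmxP[[u v] /= ->]; apply: LD.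
    by apply: LM; exact: submxMl.
  rewrite [v]mx11_scalar mul_scalar_mx; exact: LZ.
move: (row_base M) (eq_row_base M) (row_base_free M) => B BM Bfree.
pose G := B *m B^T.
have GT : G^T = G by rewrite /G trmx_mul trmxK.
have Gu : G \in unitmx.
  rewrite -row_free_unit; apply/inj_row_free => x; rewrite /G mulmxA => xG.
  have /dotvv_eq0 : dotv (x *m B) (x *m B) = 0.
    by rewrite dotv_mx trmx_mul mulmxA xG mul0mx mxE.
  by move=> /eqP; rewrite mulmx_free_eq0// => /eqP.
exists (B^T *m invmx G *m B); split.
- by rewrite trmx_mul [(B^T *m _)^T]trmx_mul trmxK trmx_inv GT mulmxA.
- by move=> x; apply: LM; rewrite -BM mulmxA submxMl.
- move=> w /ML; rewrite -BM => /submxP[y ->].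
  have GB : B *m (B^T *m invmx G *m B) = B.
    by rewrite !mulmxA mulmxV// mul1mx.
  by rewrite -[LHS]mulmxA GB.
Qed.

Lemma derive_rV (f : E -> R^o) x v : differentiable f x ->
  'D_v f x = \sum_j v ord0 j * 'D_(delta_mx ord0 j) f x.
Proof.
move=> df; rewrite deriveE// {1}[v]row_sum_delta linear_sum.
by apply: eq_bigr => j _; rewrite linearZ deriveE.
Qed.

End InnerProduct.

(** * Smooth functions on a relative interior *)

Section RelativeInterior.
Context {R : realType} {n : nat}.
Local Notation E := 'rV[R]_n.
Context (C : set E) (v0 : E)
  (C_convex : forall v w (t : R), C v -> C w -> 0 <= t <= 1 ->
     C (t *: v + (1 - t) *: w)) (Cv0 : C v0).
Local Notation L := (dirsp C).
Implicit Types (u v w d h x y : E).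

Lemma dirspB v w : C v -> C w -> L (v - w).
Proof. by move=> Cv Cw; exists 1, v, w; rewrite scale1r. Qed.

Lemma dirsp0 : L 0.
Proof. by rewrite -(subrr v0); exact: dirspB. Qed.

Lemma dirspZ (a : R) u : L u -> L (a *: u).
Proof. by case=> b [v [w [Cv Cw ->]]]; exists (a * b), v, w; rewrite scalerA. Qed.

Lemma dirsp_nneg u : L u ->
  exists2 a : R, 0 <= a & exists v w, [/\ C v, C w & u = a *: (v - w)].
Proof.
case=> a [v [w [Cv Cw ->]]]; have [a0|a0] := leP 0 a.
  by exists a => //; exists v, w.
exists (- a); first by rewrite oppr_ge0 ltW.
by exists w, v; rewrite scaleNr -scalerN opprB.
Qed.

(** With nonnegative coefficients, [a (p - q) + b (p' - q')] is [a + b] times the difference of two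
    convex combinations with the same weights. *)
Lemma dirspD u v : L u -> L v -> L (u + v).
Proof.
move=> /dirsp_nneg[a a0 [p [q [Cp Cq ->]]]].
move=> /dirsp_nneg[b b0 [p' [q' [Cp' Cq' ->]]]].
have [s0|s0] := eqVneq (a + b) 0.
  have [a00 b00] : a = 0 /\ b = 0 by split; lra.
  by rewrite a00 b00 !scale0r addr0; exact: dirsp0.
have sp : 0 < a + b by rewrite lt_neqAle eq_sym s0 addr_ge0.
have t01 : 0 <= a / (a + b) <= 1.
  by rewrite divr_ge0 ?(ltW sp)//= ler_pdivrMr// mul1r lerDl.
exists (a + b), (a / (a + b) *: p + (1 - a / (a + b)) *: p'),
  (a / (a + b) *: q + (1 - a / (a + b)) *: q'); split; try exact: C_convex.
by apply/rowP => i; rewrite !mxE; field.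
Qed.

Lemma rint_sub v : rint C v -> C v.
Proof. by case. Qed.

(** The relative interior is relatively open: displacements from a nearby [w] are displacements from
    [v], since [L] is closed under addition. *)
Lemma rint_near v : rint C v -> \forall w \near v, L (w - v) -> rint C w.
Proof.
move=> [Cv /nbhs_interior nv]; near=> w => Lw.
have nw : \forall w' \near w, L (w' - v) -> C w' by near: w.
split; first exact: nbhs_singleton nw Lw.
apply: filterS nw => w' Cw' Lw'; apply: Cw'.
by rewrite -[w'](subrK w) -addrA; exact: dirspD.
Unshelve. all: by end_near. Qed.

Lemma rint_ball v : rint C v ->
  exists2 r : R, 0 < r & forall d, `|d| < r -> L d -> rint C (v + d).
Proof.
move=> /rint_near/nbhs_ballP[r /= r0 H]; exists r => // d dr Ld.
apply: H; first by rewrite -ball_normE/= opprD addNKr normrN.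
by rewrite addrC addKr.
Qed.

Lemma ball_rint v (r : R) : 0 < r -> C v ->
  (forall d, `|d| < r -> L d -> C (v + d)) -> rint C v.
Proof.
move=> r0 Cv H; split=> //; apply/nbhs_ballP; exists r => // w.
by rewrite -ball_normE/= distrC => wr Lw; rewrite -[w](subrK v) addrC; exact: H.
Qed.

Lemma rint_convex v w (t : R) : rint C v -> rint C w -> 0 <= t <= 1 ->
  rint C (t *: v + (1 - t) *: w).
Proof.
move=> rv rw t01.
have [r r0 Hr] := rint_ball rv; have [s s0 Hs] := rint_ball rw.
apply: (@ball_rint _ (Num.min r s)); first by rewrite lt_min r0.
  by apply: C_convex => //; exact: rint_sub.
move=> d; rewrite lt_min => /andP[dr ds] Ld.
have -> : t *: v + (1 - t) *: w + d = t *: (v + d) + (1 - t) *: (w + d).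
  by apply/rowP => i; rewrite !mxE; ring.
by apply: C_convex => //; apply: rint_sub; [exact: Hr|exact: Hs].
Qed.

Lemma rint_segment v w (t : R) : rint C v -> rint C w -> 0 <= t <= 1 ->
  rint C (v + t *: (w - v)).
Proof.
move=> rv rw t01; have -> : v + t *: (w - v) = t *: w + (1 - t) *: v.
  by apply/rowP => i; rewrite !mxE; ring.
exact: rint_convex.
Qed.

Lemma rintB v w : rint C v -> rint C w -> L (v - w).
Proof. by move=> /rint_sub Cv /rint_sub; exact: dirspB. Qed.

Lemma Cn_onW k (g : E -> R) : Cn_on k.+1 L (rint C) g -> Cn_on k L (rint C) g.
Proof.
elim: k g => [|k IH] g [cg Dg]; first by split.
by split=> // h /Dg[dg ?]; split=> //; exact: IH.
Qed.

Section Retraction.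
Context (P : 'M[R]_n) (PT : P^T = P) (LP : forall x, L (x *m P))
  (PL : forall w, L w -> w *m P = w).

(* Composing with the affine retraction [pr] turns functions that are smooth
   on [rint C] along [L] into functions that are smooth on an open set. *)
Let pr x : E := v0 + (x - v0) *m P.

Let prE (t : R) h x : pr (t *: h + x) = t *: (h *m P) + pr x.
Proof. by rewrite /pr -addrA mulmxDl -scalemxAl addrCA. Qed.

Let pr_id x : C x -> pr x = x.
Proof. by move=> Cx; rewrite /pr PL ?[v0 + _]addrC ?subrK//; exact: dirspB. Qed.

Let PP : P *m P = P.
Proof.
by apply/row_matrixP => i; rewrite !rowE mulmxA PL.
Qed.

Let pr_continuous : continuous pr.
Proof.
have linf : linear (fun x => x *m P) by move=> a u v; rewrite mulmxDl scalemxAl.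
pose f : {linear E -> E} :=
  HB.pack (fun x => x *m P) (GRing.isLinear.Build _ _ _ _ _ linf).
move=> x; have -> : pr = (fun y => v0 - v0 *m P + f y).
  by apply/funext => y; rewrite /f/= /pr mulmxBl addrA addrAC.
exact: (cvgD (cvg_cst _) (@continuous_linear_rV _ _ _ f x)).
Qed.

Let pr_near x : rint C (pr x) -> \forall y \near x, rint C (pr y).
Proof.
move=> /rint_near rx; have : \forall y \near x, L (pr y - pr x) -> rint C (pr y).
  by have := @pr_continuous x _ rx.
apply: filterS => y; apply.
by rewrite /pr opprD addrACA subrr add0r -mulmxBl opprB addrA subrK.
Qed.

Let continuous_pr (g : E -> R^o) x : {within rint C, continuous g} ->
  rint C (pr x) -> {for x, continuous (g \o pr)}.
Proof.
move=> /subspace_continuousP cg rx U /(cg _ rx) gU.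
have {}gU : \forall y \near x, rint C (pr y) -> U (g (pr y)).
  exact: (@pr_continuous x _ gU).
by apply: filterS2 (pr_near rx) gU => y ry; exact.
Qed.

Let derive_pr_at (g : E -> R^o) h x : 'D_h (g \o pr) x = 'D_(h *m P) g (pr x).
Proof. exact: (derive_affine g (fun t => prE t h x)). Qed.

Let derive_pr (g : E -> R^o) h : 'D_h (g \o pr) = ('D_(h *m P) g) \o pr.
Proof. by apply/funext => x; exact: derive_pr_at. Qed.

Let derivable_pr (g : E -> R^o) h x :
  derivable g (pr x) (h *m P) -> derivable (g \o pr) x h.
Proof. exact: (derivable_affine (fun t => prE t h x)). Qed.

Let differentiable_pr (g : E -> R^o) x : Cn_on 1 L (rint C) g ->
  rint C (pr x) -> differentiable (g \o pr) x.
Proof.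
move=> [_ Dg] rx; apply: differentiable_C1 => j.
  apply: filterS (pr_near rx) => y ry; apply: derivable_pr.
  exact: (Dg _ (LP _)).1.
rewrite derive_pr; apply: continuous_pr => //.
exact: (Dg _ (LP _)).2.1.
Qed.

(** Shows that [grad] does not fall back on its default [0]. The witness is the projection to [L] of
    the ordinary gradient of [F \o pr]; symmetry of [P] keeps its products with vectors of [L]. *)
Lemma grad_exists (F : E -> R) a : Cn_on 1 L (rint C) F -> rint C a ->
  L (grad L F a) /\
  forall h, L h -> is_derive a h (F : E -> R^o) (dotv (grad L F a) h).
Proof.
move=> F1 ra; have pa := pr_id (rint_sub ra).
have dF : differentiable (F \o pr : E -> R^o) a.
  by apply: differentiable_pr => //; rewrite pa.
pose g0 : E := \row_j 'D_(delta_mx ord0 j) (F \o pr : E -> R^o) a.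
apply: (@xgetPex _ 0 [set g | L g /\ forall h, L h ->
  is_derive a h (F : E -> R^o) (dotv g h)]).
exists (g0 *m P); split=> // h Lh; apply: DeriveDef; first exact: (F1.2 _ Lh).1.
rewrite -{1}[h]PL// -{1}pa -[LHS]/((('D_(h *m P) (F : E -> R^o)) \o pr) a).
rewrite -derive_pr derive_rV// dotv_mulmx PT PL// dotvC.
by apply: eq_bigr => j _; rewrite mxE.
Qed.

(** [H] is the ordinary Hessian of [F \o pr]. It absorbs [P] because derivatives of this composite
    along [v] and [v *m P] agree. The last clause is the first-order expansion of the gradient, used
    to differentiate its inverse. *)
Lemma hessian_exists (F : E -> R) a : Cn_on 2 L (rint C) F -> rint C a ->
  exists H : 'M[R]_n, [/\ H^T = H, H *m P = H,
    forall u v, L u -> L v ->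
      'D_u ('D_v (F : E -> R^o)) a = dotv (u *m H) v &
    forall w (e : R), L w -> 0 < e -> exists2 r : R, 0 < r &
      forall d, L d -> `|d| < r ->
      `|'D_w (F : E -> R^o) (a + d) - 'D_w (F : E -> R^o) a - dotv (d *m H) w|
        <= e * `|d|].
Proof.
move=> F2 ra; have pa := pr_id (rint_sub ra).
have rpa : rint C (pr a) by rewrite pa.
pose f : E -> R^o := (F : E -> R^o) \o pr.
have df x : rint C (pr x) -> differentiable f x.
  by apply: differentiable_pr; exact: Cn_onW.
have ddf v x : rint C (pr x) -> differentiable ('D_v f) x.
  by rewrite derive_pr; apply: differentiable_pr; exact: (F2.2 _ (LP _)).2.
pose H : 'M[R]_n := \matrix_(i, j)
  'D_(delta_mx ord0 i) ('D_(delta_mx ord0 j) f) a.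
have HE u v : 'D_u ('D_v f) a = dotv (u *m H) v.
  have -> : 'D_u ('D_v f) a =
      'D_u (\sum_j v ord0 j \*: 'D_(delta_mx ord0 j) f) a.
    apply: near_eq_derive; apply: filterS (pr_near rpa) => y /df dfy.
    by rewrite derive_rV// fct_sumE.
  rewrite derive_sum; last first.
    by move=> j; apply: derivableZ; exact/diff_derivable/ddf.
  apply: eq_bigr => j _; rewrite deriveZ; last exact/diff_derivable/ddf.
  rewrite derive_rV ?mxE; last exact: ddf.
  rewrite [LHS]mulrC; congr (_ * _).
  by apply: eq_bigr => i _; rewrite !mxE.
have ccf u v : {for a, continuous ('D_u ('D_v f))}.
  rewrite derive_pr derive_pr; apply: continuous_pr => //.
  exact: ((F2.2 _ (LP _)).2.2 _ (LP _)).2.1.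
exists H; split.
- apply/matrixP => i j; rewrite !mxE; apply: derive_swap => //.
  apply: filterS (pr_near rpa) => y ry.
  by split; apply: diff_derivable; auto.
- apply/row_matrixP => i; apply: dotv_inj => v; rewrite !rowE mulmxA.
  rewrite dotv_mulmx PT -!HE.
  suff -> : 'D_(v *m P) f = 'D_v f by [].
  by rewrite !derive_pr -mulmxA PP.
- by move=> u v Lu Lv; rewrite -HE derive_pr derive_pr_at pa !PL.
- move=> w e Lw e0.
  have /diff_locallyP[_ /eqaddoP/(_ e e0)/nbhs_ballP[r /= r0 Hr]] := ddf w a rpa.
  exists r => // d Ld dr.
  have := Hr d; rewrite -ball_normE/= sub0r normrN => /(_ dr).
  rewrite -[X in X <= _]/(`|'D_w f (d + a) - ('D_w f a + 'd ('D_w f) a d)|).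
  rewrite -deriveE ?HE; last exact: ddf.
  rewrite !derive_pr_at PL// pa -[d in d + a]scale1r prE PL// scale1r pa.
  by rewrite opprD addrA [d + a]addrC.
Qed.

End Retraction.

End RelativeInterior.

(** Quotients at positive [t] suffice, since the two-sided limit is also the limit from the
    right. *)
Lemma derive_ge {R : realType} {V : normedModType R} (f : V -> R^o) x v
    (c r : R) :
  derivable f x v -> 0 < r ->
  (forall t, 0 < t < r -> t * c <= f (x + t *: v) - f x) -> c <= 'D_v f x.
Proof.
move=> df r0 H; rewrite leNgt; apply/negP => Dc.
have [e /= e0 He] : exists2 e : R, 0 < e & forall t, 0 < t < e ->
    t^-1 * (f (t *: v + x) - f x) < c.
  have /cvgr_lt/(_ _ Dc) : t^-1 *: (f (t *: v + x) - f x) @[t --> 0^'] --> 'D_v f x.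
    exact: df.
  rewrite near_withinE => /nbhs_ballP[e /= e0 He]; exists e => // t /andP[t0 te].
  by apply: He; rewrite ?gt_eqF//= /ball/= sub0r normrN gtr0_norm.
pose t := Num.min e r / 2.
have m0 : 0 < Num.min e r by rewrite lt_min e0.
have t0 : 0 < t by rewrite divr_gt0.
have : t < Num.min e r by rewrite ltr_pdivrMr// ltr_pMr// ltr1n.
rewrite lt_min => /andP[te tr].
have := He t; rewrite t0 te => /(_ isT).
rewrite ltr_pdivrMl// ltNge => /negP; apply.
by rewrite [_ + x]addrC; apply: H; rewrite t0 tr.
Qed.

(** * Self-concordant functions *)

Section SelfConcordant.
Context {R : realType} {n : nat}.
Local Notation E := 'rV[R]_n.
Context (C : set E) (v0 : E)
  (C_convex : forall v w (t : R), C v -> C w -> 0 <= t <= 1 ->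
     C (t *: v + (1 - t) *: w)) (Cv0 : C v0).
Local Notation L := (dirsp C).
Context (F : E -> R) (F3 : Cn_on 3 L (rint C) F)
  (F_sc : forall v h, rint C v -> L h -> D3 F v h <= 2 * (D2 F v h) `^ (3 / 2))
  (F_strict : strictly_convex_on (rint C) F).
Implicit Types (a b u v w d h x y : E).

Let F1 : Cn_on 1 L (rint C) F. Proof. by do 2!apply: Cn_onW. Qed.

Let F2 : Cn_on 2 L (rint C) F. Proof. exact: Cn_onW. Qed.

Let dF x h : rint C x -> L h -> derivable (F : E -> R^o) x h.
Proof. by move=> rx Lh; exact: (F1.2 _ Lh).1. Qed.

Let ddF x h : rint C x -> L h -> derivable ('D_h (F : E -> R^o)) x h.
Proof. by move=> rx Lh; exact: ((F2.2 _ Lh).2.2 _ Lh).1. Qed.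

Let dddF x h : rint C x -> L h -> derivable ('D_h ('D_h (F : E -> R^o))) x h.
Proof. by move=> rx Lh; exact: (((F3.2 _ Lh).2.2 _ Lh).2.2 _ Lh).1. Qed.

Lemma gradP x : rint C x -> L (grad L F x) /\
  forall h, L h -> is_derive x h (F : E -> R^o) (dotv (grad L F x) h).
Proof.
have [P [PT LP PL]] := orthogonal_projection (dirsp0 Cv0)
  (dirspD C_convex Cv0) (@dirspZ _ _ C).
exact: (grad_exists C_convex Cv0 PT LP PL).
Qed.

Lemma derive_grad x h : rint C x -> L h ->
  'D_h (F : E -> R^o) x = dotv (grad L F x) h.
Proof. by move=> /gradP[_ D] /D[]. Qed.

Let deriveF_scale x h (t : R) : rint C x -> L h ->
  'D_(t *: h) (F : E -> R^o) x = t * 'D_h (F : E -> R^o) x.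
Proof.
by move=> rx Lh; rewrite !derive_grad ?dotvZr//; exact: dirspZ.
Qed.

Lemma gradient_lt x y : rint C x -> rint C y -> x != y ->
  F x + 'D_(y - x) (F : E -> R^o) x < F y.
Proof.
move=> rx ry xy.
have weak z : rint C z -> x != z -> 'D_(z - x) (F : E -> R^o) x <= F z - F x.
  move=> rz xz; have Lzx : L (z - x) by exact: rintB.
  rewrite -[leLHS]opprK -deriveN; last exact: dF.
  rewrite lerNl; apply: (@derive_ge _ _ _ _ _ _ 1) => //.
    by apply: derivableN; exact: dF.
  move=> t /andP[t0 t1]; have := F_strict rz rx.
  rewrite eq_sym => /(_ xz _ t0 t1)/ltW.
  have -> : t *: z + (1 - t) *: x = x + t *: (z - x).
    by apply/rowP => i; rewrite !mxE; ring.
  by rewrite !fctE; lra.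
(* The limit of the convexity inequality is only weak. Strictness is recovered by using it at the
   midpoint, where [F] lies strictly below the chord. *)
pose m := x + (1 / 2) *: (y - x).
have mE : m = (1 / 2) *: x + (1 - 1 / 2) *: y.
  by apply/rowP => i; rewrite !mxE; field.
have h0 : 0 < 1 / 2 :> R by lra.
have h1 : 1 / 2 < 1 :> R by lra.
have rm : rint C m by apply: (rint_segment C_convex Cv0) => //; rewrite !ltW.
have xm : x != m.
  rewrite /m -subr_eq0 opprD addNKr oppr_eq0 scaler_eq0 (gt_eqF h0)/=.
  by rewrite subr_eq0 eq_sym.
have := weak _ rm xm.
have mx : m - x = (1 / 2) *: (y - x) by rewrite /m addrC addKr.
have Lyx : L (y - x) by exact: rintB.
rewrite mx deriveF_scale//.
have := F_strict rx ry xy h0 h1; rewrite -mE; lra.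
Qed.

Lemma rint_ray a h : rint C a -> L h ->
  exists2 r : R, 0 < r & forall s, 0 <= s <= r -> rint C (a + s *: h).
Proof.
move=> ra Lh; have [r r0 Hr] := rint_ball C_convex Cv0 ra.
have p0 : 0 < `|h| + 1 by rewrite ltr_wpDl.
exists (r / (`|h| + 1)); first by rewrite divr_gt0.
move=> s /andP[s0]; rewrite ler_pdivlMr// => sr.
have [->|sn0] := eqVneq s 0; first by rewrite scale0r addr0.
apply: Hr; last exact: dirspZ.
rewrite normrZ ger0_norm//; apply: lt_le_trans sr.
by rewrite ltr_pM2l ?ltrDl// lt_neqAle eq_sym sn0.
Qed.

(** The two strict gradient inequalities, at either end of the segment, are added. *)
Lemma derive_lt a h (t : R) : rint C a -> L h -> h != 0 -> 0 < t ->
  rint C (a + t *: h) ->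
  'D_h (F : E -> R^o) a < 'D_h (F : E -> R^o) (a + t *: h).
Proof.
move=> ra Lh hn0 t0 rt.
have an : a != a + t *: h.
  by rewrite -subr_eq0 opprD addNKr oppr_eq0 scaler_eq0 gt_eqF.
have := gradient_lt ra rt an.
rewrite [a + t *: h - a]addrAC subrr add0r deriveF_scale// => H1.
move: an; rewrite eq_sym => /(gradient_lt rt ra).
rewrite opprD addNKr -scaleNr deriveF_scale// => H2.
by rewrite -(ltr_pM2l t0); lra.
Qed.

Lemma D2_ge0 a h : rint C a -> L h -> 0 <= D2 F a h.
Proof.
move=> ra Lh; have [->|hn0] := eqVneq h 0; first by rewrite /D2 derive0.
have [r r0 Hr] := rint_ray ra Lh.
apply: (derive_ge (ddF ra Lh) r0) => t /andP[t0 tr]; rewrite mulr0 subr_ge0.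
by apply/ltW/derive_lt => //; apply: Hr; rewrite !ltW.
Qed.

(** Strict convexity alone allows isolated zeros of the second derivative. Self-concordance spreads
    a zero along a piece of the ray, where the first derivative would then fail to increase. *)
Lemma D2_gt0 a h : rint C a -> L h -> h != 0 -> 0 < D2 F a h.
Proof.
move=> ra Lh hn0; rewrite lt_neqAle D2_ge0// andbT eq_sym; apply/negP => /eqP a0.
have [r r0 Hr] := rint_ray ra Lh.
have [||||e /andP[e0 er] He] := @self_concordant_zero _
  (fun s => D2 F (a + s *: h) h) (fun s => D3 F (a + s *: h) h) r r0.
- by move=> s /Hr rs; apply: is_derive_line; exact: dddF.
- by move=> s /Hr rs; exact: D2_ge0.
- by move=> s /Hr rs; exact: F_sc.
- by rewrite scale0r addr0.
have re : rint C (a + e *: h) by apply: Hr; rewrite er ltW.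
have := derive_lt ra Lh hn0 e0 re; apply/negP; rewrite -leNgt -lerN2.
have := @ge0_is_derive_le _ (fun s => - 'D_h (F : E -> R^o) (a + s *: h))
  (fun s => - D2 F (a + s *: h) h) 0 e (ltW e0).
rewrite scale0r addr0; apply.
  move=> s /andP[s0 se]; apply: is_deriveN; apply: is_derive_line.
  by apply: ddF => //; apply: Hr; rewrite s0 (le_trans se).
by move=> s /He ->; rewrite oppr0.
Qed.

(** The scalar estimate is applied on the segment from [b] at [0] to [a] at [1], so the Hessian is
    the one at [a]. *)
Lemma derive_gap a b : rint C a -> rint C b ->
  D2 F a (a - b) / (1 + Num.sqrt (D2 F a (a - b))) <=
  dotv (grad L F a - grad L F b) (a - b).
Proof.
move=> ra rb; have Lab : L (a - b) by exact: rintB.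
rewrite dotvBl -!derive_grad//.
have [/eqP|abn0] := eqVneq (a - b) 0.
  by rewrite subr_eq0 => /eqP ->; rewrite subrr /D2 !derive0 mul0r subrr.
have rs s : 0 <= s <= 1 -> rint C (b + s *: (a - b)).
  exact: (rint_segment C_convex Cv0).
have := @self_concordant_gap _
  (fun s => 'D_(a - b) (F : E -> R^o) (b + s *: (a - b)))
  (fun s => D2 F (b + s *: (a - b)) (a - b))
  (fun s => D3 F (b + s *: (a - b)) (a - b)).
rewrite scale1r scale0r addr0 [b + (a - b)]addrC subrK; apply.
- by move=> s /rs ?; apply: is_derive_line; exact: ddF.
- by move=> s /rs ?; apply: is_derive_line; exact: dddF.
- by move=> s /rs ?; exact: D2_gt0.
- by move=> s /rs ?; exact: F_sc.
Qed.

Lemma bregman_ge0 a b : rint C a -> rint C b -> 0 <= bregman C F a b.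
Proof.
move=> ra rb; have [->|ab] := eqVneq b a.
  by rewrite /bregman !subrr dotv0 subr0.
have := gradient_lt rb ra ab; rewrite derive_grad//; last exact: rintB.
by rewrite /bregman; lra.
Qed.

End SelfConcordant.

Lemma is_derive_littleo {R : realType} {V : normedModType R} (f : V -> R^o) x v
    (l : R) :
  (forall e : R, 0 < e -> exists2 r : R, 0 < r & forall t : R, `|t| < r ->
     `|f (x + t *: v) - f x - t * l| <= e * `|t|) ->
  is_derive x v f l.
Proof.
move=> H.
have cl : t^-1 *: (f (t *: v + x) - f x) @[t --> (0 : R)^'] --> (l : R^o).
  apply/cvgrPdist_le => e e0; have [r r0 Hr] := H e e0.
  rewrite near_withinE; apply/nbhs_ballP; exists r => // t.
  rewrite -ball_normE/= sub0r normrN => /Hr {}Hr t0.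
  rewrite distrC [t *: v + x]addrC -[l](mulKf t0) -mulrBr.
  by rewrite normrM normfV ler_pdivrMl ?normr_gt0// [`|t| * e]mulrC.
by apply: DeriveDef; [exact: cvgP cl | exact: cvg_lim cl].
Qed.

Lemma sup_translate {R : realType} (A : set R) (c : R) :
  A !=set0 -> has_ubound A -> sup [set x + c | x in A] = sup A + c.
Proof.
move=> A0 Au; have [x0 Ax0] := A0; apply/eqP; rewrite eq_le; apply/andP; split.
  apply: ge_sup; first by exists (x0 + c), x0.
  by move=> _ [x Ax <-]; rewrite lerD2r; exact: ub_le_sup.
rewrite -lerBrDr; apply: ge_sup => // x Ax; rewrite lerBrDr.
apply: ub_le_sup; last by exists x.
have [M AM] := Au; exists (M + c) => _ [y Ay <-]; rewrite lerD2r; exact: AM.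
Qed.

(** * The dual and the mirror step *)

Section MirrorStep.
Context {R : realType} {n : nat}.
Local Notation E := 'rV[R]_n.
Context (C : set E) (v0 : E)
  (C_convex : forall v w (t : R), C v -> C w -> 0 <= t <= 1 ->
     C (t *: v + (1 - t) *: w)) (rv0 : rint C v0).
Local Notation L := (dirsp C).
Context (F : E -> R) (bF : legendre_barrier C F)
  (dual_ub : forall h, has_ubound [set dotv h v - F v | v in rint C]).
Implicit Types (a b d f h k u v w x y : E).

Let Cv0 : C v0 := rint_sub rv0.

Let F3 : Cn_on 3 L (rint C) F. Proof. by have [] := lb_self_concordant bF. Qed.

Let F_sc v h : rint C v -> L h -> D3 F v h <= 2 * (D2 F v h) `^ (3 / 2).
Proof. by have [_ _] := lb_self_concordant bF; apply. Qed.

Let gap := derive_gap C_convex Cv0 F3 F_sc (lb_strict bF).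

Let rintBL v w : rint C v -> rint C w -> L (v - w).
Proof. exact: rintB. Qed.

Lemma grad_dual_coord h j :
  grad_dual C F h ord0 j = 'D_(delta_mx ord0 j) (dual C F : E -> R^o) h.
Proof.
have dd := lb_dual_diff bF h.
have [_ G] : setT (grad_dual C F h) /\ forall k, setT k ->
    is_derive h k (dual C F : E -> R^o) (dotv (grad_dual C F h) k).
  apply: (@xgetPex _ 0 [set g | setT g /\ forall k, setT k ->
    is_derive h k (dual C F : E -> R^o) (dotv g k)]).
  exists (\row_j 'D_(delta_mx ord0 j) (dual C F : E -> R^o) h); split=> // k _.
  apply: DeriveDef; first exact: diff_derivable.
  by rewrite derive_rV//; apply: eq_bigr => i _; rewrite mxE mulrC.
by have [_ ->] := G (delta_mx ord0 j) I; rewrite dotv_delta.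
Qed.

(** A vector orthogonal to [L] has the same product with all points of [rint C], so it shifts the
    supremum by a constant. *)
Lemma dual_shift h k : (forall w, L w -> dotv k w = 0) ->
  dual C F (h + k) = dual C F h + dotv k v0.
Proof.
move=> k0; rewrite /dual -sup_translate//; last by exists (dotv h v0 - F v0), v0.
congr sup; rewrite image_comp; apply: eq_imagel => v rv /=.
have := k0 _ (rintBL rv rv0); rewrite dotvBr => /eqP; rewrite subr_eq0 => /eqP <-.
by rewrite dotvDl addrAC.
Qed.

Lemma grad_dual_shift h k : (forall w, L w -> dotv k w = 0) ->
  grad_dual C F (h + k) = grad_dual C F h.
Proof.
move=> k0; apply/rowP => j; rewrite !grad_dual_coord.
rewrite -(@derive_affine _ _ _ (dual C F) (fun x => x + k) h
  (delta_mx ord0 j)); last first.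
  by move=> t; rewrite addrA.
have -> : (dual C F : E -> R^o) \o (fun x => x + k) =
    (dual C F : E -> R^o) \+ cst (dotv k v0).
  by apply/funext => x /=; rewrite dual_shift.
rewrite deriveD ?derive_cst ?addr0//.
exact/diff_derivable/(lb_dual_diff bF).
Qed.

(** The bijection reaches only vectors of [L]. A general [h] is replaced by [h *m P], which changes
    neither the dual gradient nor products with [L]. *)
Lemma grad_grad_dual h : rint C (grad_dual C F h) /\
  forall w, L w -> dotv (grad L F (grad_dual C F h)) w = dotv h w.
Proof.
have [P [PT LP PL]] := orthogonal_projection (dirsp0 Cv0)
  (dirspD C_convex Cv0) (@dirspZ _ _ C).
have [_ _ surj] := lb_grad_bij bF.
have [b rb bE] := surj _ (LP h).
have -> : grad_dual C F h = b.
  rewrite -(lb_grad_inv bF rb) bE -[in LHS](subrK (h *m P) h) addrC.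
  apply: grad_dual_shift => w Lw.
  by rewrite dotvBl dotv_mulmx PT PL// subrr.
by split=> // w Lw; rewrite bE dotv_mulmx PT PL.
Qed.

(* [Z], the inverse of the Hessian [H] of [F] on [L] extended by [0] on the
   orthogonal complement, is the transpose of the Hessian of the dual.  The gap
   estimate gives [x t - a = O(t)] for [x t], the dual gradient at
   [grad L F a + t *: k]; expanding the [F]-gradient at [a] in the directions
   [e_j Z] then identifies the derivative of [x] at [0]. *)
Lemma hessian_dual_ge a f w : rint C a -> L w ->
  0 <= (f *m hessian (dual C F) (grad L F a) *m f^T) ord0 ord0 /\
  dotv f w ^+ 2 <=
  (f *m hessian (dual C F) (grad L F a) *m f^T) ord0 ord0 * D2 F a w.
Proof.
move=> ra Lw.
have [P [PT LP PL]] := orthogonal_projection (dirsp0 Cv0)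
  (dirspD C_convex Cv0) (@dirspZ _ _ C).
have PP : P *m P = P by apply/row_matrixP => i; rewrite !rowE mulmxA PL.
have F2 : Cn_on 2 L (rint C) F by exact: Cn_onW.
have [H [HT HP HE Hfrechet]] := hessian_exists C_convex Cv0 PT LP PL F2 ra.
have PH : P *m H = H by rewrite -[P]PT -{1}HT -trmx_mul HP.
have D2E u : L u -> D2 F a u = dotv (u *m H) u by move=> Lu; rewrite -HE.
have quadP x : dotv (x *m H) x = D2 F a (x *m P).
  by rewrite D2E// -[x *m P *m H]mulmxA PH -[in LHS]HP mulmxA dotv_mulmx PT.
have quad0 x : 0 <= dotv (x *m H) x.
  by rewrite quadP; apply: (D2_ge0 C_convex Cv0 F3 (lb_strict bF)).
(* [S] acts as [H] on [L] and as the identity on the orthogonal complement, hence is positive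
   definite. *)
pose S := H + (1%:M - P).
have Su : S \in unitmx.
  apply: unitmx_posdef => x x0; rewrite /S mulmxDr dotvDl quadP.
  have -> : dotv (x *m (1%:M - P)) x = dotv (x - x *m P) (x - x *m P).
    rewrite mulmxBr mulmx1 [in RHS]dotvBr.
    have -> : dotv (x - x *m P) (x *m P) = dotv ((x - x *m P) *m P) x.
      by rewrite [RHS]dotv_mulmx PT.
    by rewrite mulmxBl -mulmxA PP subrr [dotv 0 _]dotvC dotv0 subr0.
  have [xP0|xP0] := eqVneq (x *m P) 0.
    rewrite xP0 subr0 /D2 derive0 add0r lt_neqAle dotvv_ge0 andbT eq_sym.
    by apply/negP => /eqP/dotvv_eq0/eqP; apply/negP.
  apply: ltr_wpDr (dotvv_ge0 _) _.
  exact: (D2_gt0 C_convex Cv0 F3 F_sc (lb_strict bF)).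
have SP : S *m P = P *m S.
  by rewrite /S mulmxDl mulmxDr HP PH mulmxBl mulmxBr mul1mx mulmx1.
have iSP : invmx S *m P = P *m invmx S.
  rewrite -[LHS]mulmx1 -(mulmxV Su) mulmxA -[invmx S *m P *m S]mulmxA -SP.
  by rewrite mulmxA mulVmx// mul1mx.
pose Z := P *m invmx S.
have ZP : Z *m P = Z by rewrite /Z -mulmxA iSP mulmxA PP.
have ZH : Z *m H = P.
  have <- : Z *m S = P by rewrite /Z -mulmxA mulVmx// mulmx1.
  by rewrite /S mulmxDr mulmxBr mulmx1 ZP subrr addr0.
have HZ : H *m Z^T = P by rewrite -{1}HT -trmx_mul ZH PT.
have LZ k : L (k *m Z) by rewrite -ZP mulmxA.
have fZE k : dotv (k *m Z *m H) (k *m Z) = dotv (k *m Z^T) k.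
  by rewrite -mulmxA ZH dotv_mulmx PT -mulmxA ZP dotv_mulmx trmxK.
have cs k u : L u -> dotv k u ^+ 2 <= dotv (k *m Z *m H) (k *m Z) * D2 F a u.
  move=> Lu; rewrite D2E//.
  have -> : dotv k u = dotv (k *m Z *m H) u.
    by rewrite -mulmxA ZH dotv_mulmx PT PL.
  exact: cauchy_schwarz_mx.
have hessE : hessian (dual C F) (grad L F a) = Z^T; last first.
  rewrite hessE -dotv_mx -fZE; split; [exact: quad0|exact: cs].
pose m k := Num.sqrt (dotv (k *m Z *m H) (k *m Z)).
have cs' k u : L u -> `|dotv k u| <= m k * Num.sqrt (D2 F a u).
  by move=> Lu; rewrite -sqrtrM// -sqrtr_sqr ler_wsqrtr// cs.
suff GD k j : is_derive (grad L F a) k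
    (fun h => grad_dual C F h ord0 j : R^o) ((k *m Z^T) ord0 j).
  apply/matrixP => i j; rewrite mxE.
  have -> : 'D_(delta_mx ord0 j) (dual C F : E -> R^o) =
      (fun h => grad_dual C F h ord0 j).
    by apply/funext => h; rewrite grad_dual_coord.
  by have [_ ->] := GD (delta_mx ord0 i) j; rewrite -rowE mxE.
pose A := grad L F a.
(* Coordinate [i] of [x t - a] is at most [m e_i] times the local norm of the difference, which is
   at most [2 * m k * |t|]. *)
pose K := 2 * m k * \sum_i m (delta_mx ord0 i).
have m0 u : 0 <= m u by exact: sqrtr_ge0.
have K0 : 0 <= K by rewrite mulr_ge0 ?mulr_ge0// sumr_ge0.
pose x (t : R) := grad_dual C F (A + t *: k).
have rx t : rint C (x t) by exact: (grad_grad_dual _).1.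
have Ldx t : L (x t - a) by exact: rintBL.
have gx t u : L u -> dotv (grad L F (x t) - A) u = t * dotv k u.
  move=> Lu; rewrite dotvBl (grad_grad_dual _).2// dotvDl dotvZl.
  by rewrite addrAC subrr add0r.
have dx (t : R) : `|t| * m k <= 1 / 2 -> `|x t - a| <= K * `|t|.
  move=> tm; set r := Num.sqrt (D2 F a (a - x t)).
  have r0 : 0 <= r by exact: sqrtr_ge0.
  have Lax : L (a - x t) by exact: rintBL.
  have r2 : r ^+ 2 = D2 F a (a - x t).
    by rewrite sqr_sqrtr// (D2_ge0 C_convex Cv0 F3 (lb_strict bF)).
  have : r ^+ 2 <= `|t| * m k * r * (1 + r).
    rewrite -ler_pdivrMr; last by rewrite ltr_wpDr.
    rewrite r2; apply: le_trans (gap ra (rx t)) _.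
    rewrite -opprB dotvNl gx// -mulNr (le_trans (ler_norm _))// normrM normrN.
    by rewrite -mulrA ler_wpM2l// cs'.
  move=> rle; have {}rle : r <= 2 * (`|t| * m k).
    have [->|rn0] := eqVneq r 0; first by rewrite !mulr_ge0.
    have rp : 0 < r by rewrite lt_neqAle eq_sym rn0.
    have : r <= `|t| * m k * (1 + r).
      by rewrite -(ler_pM2r rp) -expr2 (le_trans rle)// mulrAC.
    by nra.
  apply/rV_normP; first by rewrite mulr_ge0.
  move=> i; rewrite -dotv_delta dotvC -opprB dotvNr normrN.
  apply: le_trans (cs' _ _ Lax) _; rewrite -/r.
  apply: (@le_trans _ _ (m (delta_mx ord0 i) * (2 * (`|t| * m k)))).
    by rewrite ler_wpM2l.
  have : m (delta_mx ord0 i) <= \sum_j m (delta_mx ord0 j).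
    by rewrite (bigD1 i)//= lerDl sumr_ge0.
  have : 0 <= `|t| * m k by rewrite mulr_ge0.
  rewrite /K; nra.
apply: is_derive_littleo => e e0.
have K1 : 0 < K + 1 by rewrite ltr_wpDl.
have mk1 : 0 < 2 * m k + 1 by rewrite ltr_wpDl// mulr_ge0.
have [r r0 Hr] :=
  Hfrechet (delta_mx ord0 j *m Z) (e / (K + 1)) (LZ _) (divr_gt0 e0 K1).
(* The second bound on [|t|] gives [|t| * m k <= 1 / 2], as [dx] requires; the first then puts [x t]
   where the expansion at [a] holds. *)
exists (Num.min (r / (K + 1)) (2 * m k + 1)^-1).
  by rewrite lt_min divr_gt0// invr_gt0.
move=> t; rewrite lt_min => /andP[tr tm].
have {tm}dxt : `|x t - a| <= K * `|t|.
  apply: dx; move: tm; rewrite -[_^-1]mul1r ltr_pdivlMr//.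
  by have := normr_ge0 t; have := m0 k; nra.
have {}tr : `|x t - a| < r.
  apply: le_lt_trans dxt _; move: tr; rewrite ltr_pdivlMr//.
  by have := normr_ge0 t; nra.
have := Hr _ (Ldx t) tr; rewrite [a + _]addrC subrK.
rewrite !(derive_grad C_convex Cv0 F3)// -dotvBl gx//.
(* Since [H *m Z^T = P], the linear term in direction [e_j Z] is coordinate [j] of [x t - a], while
   the gradient difference is [t] times coordinate [j] of [k *m Z^T]. *)
rewrite dotvC -[dotv (_ *m H) _]dotvC !dotv_mulmx ![dotv (delta_mx _ _) _]dotvC.
rewrite !dotv_delta -[_ *m H *m Z^T]mulmxA HZ PL// -/A -/(x t).
rewrite [grad_dual C F A](lb_grad_inv bF ra) distrC.
rewrite ![(x t - a) _ _]mxE ![(- a) _ _]mxE.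
move=> /le_trans; apply; apply: (@le_trans _ _ (e / (K + 1) * (K * `|t|))).
  by rewrite ler_wpM2l// ltW// divr_gt0.
rewrite mulrA ler_wpM2r// mulrAC ler_pdivrMr// ler_pM2l//.
by rewrite lerDl.
Qed.

Lemma dotv_dual_norm a f w : rint C a -> L w ->
  `|dotv f w| <= dual_norm C F (grad L F a) f * Num.sqrt (D2 F a w).
Proof.
move=> ra Lw; have [q0 q] := hessian_dual_ge f ra Lw.
by rewrite /dual_norm -sqrtrM// -sqrtr_sqr ler_wsqrtr.
Qed.

Lemma bregman_three_points a b u :
  bregman C F u b = bregman C F u a + bregman C F a b +
    dotv (grad L F a - grad L F b) (u - a).
Proof.
by rewrite /bregman !(dotvBr, dotvBl); ring.
Qed.

(* [bregman b a >= 0] bounds [bregman a b] by the symmetrized divergence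
   [<grad a - grad b, a - b>], to which the dual norm and the gap estimate
   apply. *)
Lemma bregman_mirror_step a f (rho : R) :
  let b := grad_dual C F (grad L F a - rho *: f) in
  rint C a -> 0 < rho ->
  rho * dual_norm C F (grad L F a) f <= 1 / 2 ->
  dual_norm C F (grad L F a) f <= 1 ->
  bregman C F a b <= 2 * rho ^+ 2.
Proof.
move=> b ra rho0 l2 l1; have [rb gb] := grad_grad_dual (grad L F a - rho *: f).
rewrite -/b in rb gb.
have Lab : L (a - b) by exact: rintBL.
have := bregman_ge0 C_convex Cv0 F3 (lb_strict bF) rb ra.
have gE : dotv (grad L F a - grad L F b) (a - b) = rho * dotv f (a - b).
  by rewrite dotvBl gb// dotvBl dotvZl; ring.
have := gap ra rb; rewrite gE.
have := dotv_dual_norm f ra Lab; rewrite ler_norml => /andP[_].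
set l := dual_norm _ _ _ _ in l1 l2 *; set r := Num.sqrt _.
have -> : D2 F a (a - b) = r ^+ 2.
  by rewrite sqr_sqrtr// (D2_ge0 C_convex Cv0 F3 (lb_strict bF)).
have r0 : 0 <= r by exact: sqrtr_ge0.
have l0 : 0 <= l by exact: sqrtr_ge0.
move=> fl; rewrite ler_pdivrMr ?ltr_wpDr// => rle ge0.
have ble : bregman C F a b <= rho * dotv f (a - b).
  move: ge0; rewrite -gE /bregman -[b - a]opprB dotvNr.
  by rewrite [in dotv (_ - _) _]dotvBl; lra.
apply: (le_trans ble).
have frl : rho * dotv f (a - b) <= rho * l * r by rewrite -mulrA ler_pM2l.
apply: (le_trans frl).
(* Dividing by [r] gives [r <= rho * l * (1 + r)], and [rho * l <= 1 / 2] absorbs the [r] on the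
   right. *)
have {}rle : r <= 2 * (rho * l).
  have [->|rn0] := eqVneq r 0; first by rewrite !mulr_ge0// ltW.
  have rp : 0 < r by rewrite lt_neqAle eq_sym rn0.
  have : r <= rho * l * (1 + r).
    rewrite -(ler_pM2r rp) -expr2 (le_trans rle)//.
    by rewrite [leRHS]mulrAC ler_wpM2r// addr_ge0.
  by nra.
have rl0 : 0 <= rho * l by rewrite mulr_ge0// ltW.
have rl : rho * l <= rho by rewrite ger_pMr.
nra.
Qed.

Lemma mirror_descent_rint (rho : R) nu1 s : rint C nu1 ->
  rint C (mirror_descent C F rho nu1 s).
Proof.
move=> r1; case/lastP: s => // s f.
by rewrite /mirror_descent foldl_rcons; exact: (grad_grad_dual _).1.
Qed.

(** In the three-point identity the linear term turns the new loss of [mu] into that of [nu], which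
    cancels the first summand. What remains, [D_F(nu, b) / rho], is paid by the [2 * rho] released
    when one round fewer is left. *)
Lemma mirror_relaxation_step (rho : R) nu1 T (G' : set E) s f :
  let nu := mirror_descent C F rho nu1 s in
  rint C nu1 -> 0 < rho -> G' `<=` rint C ->
  rho * dual_norm C F (grad L F nu) f <= 1 / 2 ->
  dual_norm C F (grad L F nu) f <= 1 ->
  ((dotv nu f)%:E + mirror_relaxation C F rho nu1 T G' (rcons s f) <=
   mirror_relaxation C F rho nu1 T G' s)%E.
Proof.
move=> nu r1 rho0 G'C l2 l1.
have rnu : rint C nu by exact: mirror_descent_rint.
have step := bregman_mirror_step rnu rho0 l2 l1.
have [rb gb] := grad_grad_dual (grad L F nu - rho *: f).
rewrite /mirror_relaxation.
set A' := (X in ereal_sup X); set A := [set _ | _ in _].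
set d' := 2 * rho * (T%:R - (size (rcons s f))%:R); set d := 2 * rho * _.
have dE : d = d' + 2 * rho.
  by rewrite /d /d' size_rcons -natr1; ring.
have supA : (ereal_sup A' <= ereal_sup A + (2 * rho - dotv nu f)%:E)%E.
  apply: ge_ereal_sup => _ [mu G'mu <-].
  apply: (@le_trans _ _ ((\sum_(g <- s) dotv mu (- g) +
      rho^-1 * bregman C F mu nu)%:E + (2 * rho - dotv nu f)%:E)%E); last first.
    by apply: leeD2r; apply: ereal_sup_ubound; exists mu.
  rewrite -EFinD lee_fin big_rcons/= {1}/mirror_descent foldl_rcons.
  rewrite -/(mirror_descent _ _ _ _ _) -/nu.
  set b := grad_dual C F _.
  have Lmu : L (mu - nu) by apply: rintBL => //; exact: G'C.
  have -> : bregman C F mu b =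
      bregman C F mu nu + bregman C F nu b + rho * (dotv f mu - dotv f nu).
    rewrite (bregman_three_points nu); congr (_ + _).
    by rewrite dotvBl gb// dotvBl dotvZl !dotvBr; ring.
  have : rho^-1 * bregman C F nu b <= 2 * rho.
    by rewrite ler_pdivrMl// mulrCA -expr2.
  rewrite [rho^-1 * (_ + _ * _)]mulrDr mulKf ?gt_eqF//.
  by rewrite (mulrDr _ (bregman C F mu nu)) dotvNr ![dotv _ f]dotvC; lra.
apply: (@le_trans _ _ ((dotv nu f)%:E +
    (ereal_sup A + (2 * rho - dotv nu f)%:E + d'%:E))%E).
  by apply: leeD2l; exact: leeD2r.
(* The supremum may be infinite, for instance [-oo] when [G'] is empty. *)
by case: (ereal_sup A) => [r| |] //; rewrite -!EFinD lee_fin dE; lra.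
Qed.

End MirrorStep.

(** * The state-action polytope *)

Section Polytope.
Context {R : realType} {X U : finType} (K : X -> U -> X -> R).
Local Notation E := 'rV[R]_#|{: X * U}|.
Local Notation G := (state_action_polytope K).

Lemma evD (v w : E) x u : ev (v + w) x u = ev v x u + ev w x u.
Proof. by rewrite /ev mxE. Qed.

Lemma evZ (a : R) (v : E) x u : ev (a *: v) x u = a * ev v x u.
Proof. by rewrite /ev mxE. Qed.

Lemma convex_state_action_polytope (v w : E) (t : R) :
  G v -> G w -> 0 <= t <= 1 -> G (t *: v + (1 - t) *: w).
Proof.
move=> [v0 v1 vK] [w0 w1 wK] /andP[t0 t1].
have sumE (I : finType) (c p q : I -> R) :
    \sum_i c i * (t * p i + (1 - t) * q i) =
    t * (\sum_i c i * p i) + (1 - t) * \sum_i c i * q i.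
  by rewrite !mulr_sumr -big_split/=; apply: eq_bigr => i _; ring.
have evE x u :
    ev (t *: v + (1 - t) *: w) x u = t * ev v x u + (1 - t) * ev w x u.
  by rewrite evD !evZ.
split=> [x u||y].
- by rewrite evE addr_ge0 ?mulr_ge0// subr_ge0.
- transitivity
    (t * (\sum_x \sum_u ev v x u) + (1 - t) * \sum_x \sum_u ev w x u).
    rewrite !mulr_sumr -big_split/=; apply: eq_bigr => x _.
    by rewrite !mulr_sumr -big_split/=; apply: eq_bigr => u _; rewrite evE.
  by rewrite v1 w1; ring.
- have -> : \sum_u ev (t *: v + (1 - t) *: w) y u =
      t * (\sum_u ev v y u) + (1 - t) * \sum_u ev w y u.
    by rewrite !mulr_sumr -big_split/=; apply: eq_bigr => u _; rewrite evE.
  rewrite -vK -wK !mulr_sumr -big_split/=; apply: eq_bigr => x _.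
  by rewrite -sumE; apply: eq_bigr => u _; rewrite evE.
Qed.

Lemma state_action_polytope_le1 (v : E) j : G v -> 0 <= v ord0 j <= 1.
Proof.
move=> [v0 v1 _]; have -> : v ord0 j = ev v (enum_val j).1 (enum_val j).2.
  by rewrite /ev -surjective_pairing enum_valK.
rewrite v0/= -v1 (bigD1 (enum_val j).1)//= (bigD1 (enum_val j).2)//=.
by rewrite -addrA lerDl addr_ge0// ?sumr_ge0// => x _; rewrite ?sumr_ge0.
Qed.

(** Ensures that the real [sup] in [dual] is a true supremum: coordinates in the polytope lie in
    [[0, 1]], so the l1 norm of [h] is a bound. *)
Lemma has_ubound_dual (F : E -> R) (h : E) : (forall v, rint G v -> 0 <= F v) ->
  has_ubound [set dotv h v - F v | v in rint G].
Proof.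
move=> F0; exists (\sum_j `|h ord0 j|) => _ [v rv <-].
rewrite lerBlDr ler_wpDr ?F0// ler_sum// => j _.
have /andP[v0 v1] := state_action_polytope_le1 j rv.1.
apply: le_trans (ler_norm _) _.
by rewrite normrM ler_piMr// ger0_norm.
Qed.

End Polytope.

(** * Admissibility of the relaxation and of mirror descent *)

Theorem proposition5 (R : realType) (X U : finType) (K : X -> U -> X -> R)
  (calF : set 'rV[R]_#|{: X * U}|) (T : nat)
  (F : 'rV[R]_#|{: X * U}| -> R) (rho : R)
  (nu1 : 'rV[R]_#|{: X * U}|) (G' : set 'rV[R]_#|{: X * U}|)
  (G := state_action_polytope K)
  (nu := mirror_descent G F rho nu1)
  (V := mirror_relaxation G F rho nu1 T G') :
  transition_kernel K ->
  rint G !=set0 ->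
  legendre_barrier G F ->
  is_argmin (rint G) F nu1 ->
  0 < rho ->
  G' `<=` rint G ->
  (forall fs : T.-tuple 'rV[R]_#|{: X * U}|, costs calF fs -> forall t : 'I_T,
     rho * dual_norm G F (grad (dirsp G) F (nu (take t fs))) (tnth fs t)
       <= 1 / 2) ->
  (forall fs : T.-tuple 'rV[R]_#|{: X * U}|, costs calF fs -> forall t : 'I_T,
     dual_norm G F (grad (dirsp G) F (nu (take t fs))) (tnth fs t) <= 1) ->
  [/\ (forall fs : T.-tuple 'rV[R]_#|{: X * U}|, costs calF fs ->
         forall t, (t < T)%N -> G' (nu (take t fs))) ->
        admissible_relaxation calF T G' V,
      relaxation_step calF T (rint G) V,
      relaxation_final calF T G' V
    & admissible_algorithm calF T nu V].
Proof.
move=> _ _ bF [r1 _] rho0 G'G l2 l1.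
have convG := @convex_state_action_polytope R X U K.
have ubG h := has_ubound_dual h (lb_min bF).2.
have rnu s : rint G (nu s) by exact: (mirror_descent_rint convG r1 bF ubG).
have alg : admissible_algorithm calF T nu V.
  move=> fs cfs t tT; apply: ge_ereal_sup => _ [f cf <-].
  have st : size (take t fs) = t by rewrite size_takel// size_tuple ltnW.
  (* The norm bounds concern entries of cost tuples, so [f] replaces the entry of [fs] at index [t];
     the iterate depends only on the earlier entries and is unchanged. *)
  have sfs' : size (take t fs ++ f :: drop t.+1 fs) == T.
    by rewrite size_cat st /= size_drop size_tuple addnS -addSn subnKC.
  have cfs' : costs calF (Tuple sfs').
    move=> g; rewrite mem_cat inE => /orP[/mem_take|/orP[/eqP ->//|/mem_drop]];
      exact: cfs.
  have tk : take t (Tuple sfs') = take t fs by rewrite /= take_size_cat.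
  have tf : tnth (Tuple sfs') (Ordinal tT) = f.
    by rewrite (tnth_nth f)/= nth_cat st ltnn subnn.
  have := l2 _ cfs' (Ordinal tT); have := l1 _ cfs' (Ordinal tT).
  rewrite tf [take _ _]tk => h1 h2.
  exact: (mirror_relaxation_step convG r1 bF ubG).
(* The iterate witnesses the infimum over any [D] that contains it. Iterates always lie in [rint G],
   but in [G'] only by assumption, whence the two forms in the conclusion. *)
have step D : (forall fs : T.-tuple _, costs calF fs -> forall t, (t < T)%N ->
    D (nu (take t fs))) -> relaxation_step calF T D V.
  move=> Dnu fs cfs t tT; apply: le_trans (alg _ cfs _ tT).
  by apply: ereal_inf_lbound; exists (nu (take t fs)) => //; exact: Dnu.
have fin : relaxation_final calF T G' V.
  move=> fs _; rewrite /V /mirror_relaxation size_tuple subrr mulr0 adde0.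
  rewrite leeNl; apply: le_ereal_inf_tmp => _ [mu G'mu <-].
  rewrite leeNl; apply: (@le_trans _ _ (\sum_(f <- fs) dotv mu (- f) +
    rho^-1 * bregman G F mu (nu fs))%:E); last first.
    by apply: ereal_sup_ubound; exists mu.
  rewrite -EFinN lee_fin -sumrN.
  under [X in _ <= X + _]eq_bigr do rewrite dotvNr.
  rewrite lerDl mulr_ge0 ?invr_ge0 ?(ltW rho0)//.
  have [_ F3 _] := lb_self_concordant bF.
  apply: (bregman_ge0 convG (rint_sub r1) F3 (lb_strict bF)); last exact: rnu.
  exact: G'G.
split=> //; last exact: step.
by move=> /step.
Qed.
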